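(* Let $k\in\mathbb N$ and let $E$ be a countably normed nuclear Fréchet space with a $k$-dimensional decomposition $(E_n)_{n\in\mathbb N}$. Then for any sequence $(x_n)_{n\in\mathbb N}$ of nonzero vectors with $x_n\in E_n$ for all $n\in\mathbb N$, the sequence $(x_n)$ has a complemented subsequence; and the subspace $[E_n]_{n\in M}$ of $E$ has a basis for some infinite subset $M$ of $\mathbb N$.
   Context: Spaces are over $\mathbb R$ or $\mathbb C$. A Fréchet space is a complete metrizable locally convex space. A locally convex space is countably normed if its topology is defined by a countable set of pairwise compatible norms, where two norms are compatible if every sequence that is Cauchy in both norms and converges to zero in one of them also converges to zero in the other. A finite dimensional decomposition (FDD) of $E$ is a sequence $(A_n)_{n\in\mathbb N}$ of continuous linear operators $A_n:E\to E$ with $\dim A_n(E)<\infty$, $A_nA_m=\delta_{mn}A_n$, and $x=\sum_{n=1}^\infty A_nx$ for all $x\in E$; one writes $E_n:=A_n(E)$. It is a $k$-dimensional decomposition if $\dim E_n=k$ for all $n$. $[\,\cdot\,]$ denotes closed linear span, so $[E_n]_{n\in M}=\overline{\bigoplus_{n\in M}E_n}$. A subspace is complemented in $E$ if it is the image of a continuous linear projection of $E$; a subsequence $(x_n)_{n\in M}$ ($M$ an infinite subset of $\mathbb N$) is complemented if $[x_n]_{n\in M}$ is complemented in $E$. Basis means Schauder basis. *)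

(* Defs.v *)
From HB Require Import structures.
From mathcomp Require Import all_boot all_order all_algebra.
From mathcomp Require Import complex.
From mathcomp Require Import boolp classical_sets functions cardinality reals.
From mathcomp Require Import topology normedtype sequences.

Set Implicit Arguments.
Unset Strict Implicit.
Unset Printing Implicit Defensive.

Import Order.TTheory GRing.Theory Num.Theory.
Import numFieldNormedType.Exports.

Local Open Scope classical_set_scope.
Local Open Scope ring_scope.

(* A [realType] is a model of the real numbers, unique up to isomorphism. *)
Variant real_or_complex (R : realType) : numFieldType -> Prop :=
  | scalars_real : real_or_complex R R
  | scalars_complex : real_or_complex R R[i].

(* As for the library's norms, seminorms and distances take their values in
   the scalar field [K]; when [K] is [R[i]], the relation [0 <= z] says that
   [z] is real and nonnegative, so these values are nonnegative reals. *)

Section Seminorms.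
Variables (K : numFieldType) (E : lmodType K).
Implicit Types (p q : E -> K) (u : nat -> E).

Definition is_seminorm p :=
  [/\ forall x, 0 <= p x,
      forall x y, p (x + y) <= p x + p y
    & forall (a : K) x, p (a *: x) = `|a| * p x].

Definition is_norm p := is_seminorm p /\ forall x, p x = 0 -> x = 0.

Definition cauchy_for p u :=
  forall e : K, 0 < e ->
    exists N : nat, forall m n : nat, (N <= m)%N -> (N <= n)%N ->
      p (u m - u n) < e.

Definition null_for p u := p (u n) @[n --> \oo] --> (0 : K).

Definition compatible p q :=
  forall u, cauchy_for p u -> cauchy_for q u -> (null_for p u <-> null_for q u).

End Seminorms.

Definition metrizable (K : numFieldType) (T : topologicalType) :=
  exists d : T -> T -> K,
    [/\ forall x y, 0 <= d x y,
        forall x y, d x y = 0 <-> x = y,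
        forall x y, d x y = d y x,
        forall x y z, d x z <= d x y + d y z
      & forall (x : T) (U : set T),
          nbhs x U <-> exists2 e : K, 0 < e & [set y | d x y < e] `<=` U].

(* A [tvsType] carries a uniformity that induces its topology but need not be
   translation invariant. Completeness is therefore expressed through the
   neighbourhoods of 0, i.e. for the canonical uniformity of the topological
   vector space. *)
Definition complete_tvs (K : numFieldType) (E : tvsType K) :=
  forall F : set_system E, ProperFilter F ->
    (forall U : set E, nbhs 0 U ->
       exists2 B : set E, F B & forall x y, B x -> B y -> U (x - y)) ->
    exists x : E, F --> x.

(* Local convexity is part of [tvsType]. *)
Definition frechet (K : numFieldType) (E : tvsType K) :=
  metrizable K E /\ complete_tvs E.

(* The countable set of norms is listed as a sequence, repetitions allowed. *)
Definition countably_normed (K : numFieldType) (E : tvsType K) :=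
  exists p : nat -> E -> K,
    [/\ forall i, is_norm (p i),
        forall i j, compatible (p i) (p j)
      & forall (x : E) (U : set E),
          nbhs x U <->
          exists (N : nat) (e : K), 0 < e /\
            [set y | forall i, (i < N)%N -> p i (y - x) < e] `<=` U].

Section Nuclearity.
Variable K : numFieldType.

(* T x = \sum_n l_n f_n(x) y_n with (l_n) absolutely summable and with f_n, y_n
   in the closed unit balls of X' and Y. *)
Definition nuclear_operator (X Y : normedModType K) (T : X -> Y) :=
  exists (l : nat -> K) (f : nat -> {linear X -> K^o}) (y : nat -> Y),
    [/\ cvgn (series (fun n => `|l n|)),
        forall n x, `|f n x| <= `|x|,
        forall n, `|y n| <= 1
      & forall x, series (fun n => (l n * f n x) *: y n) @ \oo --> T x].

(* [B] with [j] is the local Banach space of the seminorm [p], that is, the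
   completion of E / ker p with the norm induced by [p]; it always exists and
   is unique up to isometric isomorphism. *)
Definition local_banach (E : lmodType K) (p : E -> K)
    (B : completeNormedModType K) (j : {linear E -> B}) :=
  (forall x, `|j x| = p x) /\ dense (range j).

(* Every continuous seminorm p is dominated by a continuous seminorm q such
   that the linking map between the local Banach spaces of q and p, i.e. the
   continuous extension of x + ker q |-> x + ker p, is nuclear. *)
Definition nuclear_space (E : tvsType K) :=
  forall p : E -> K, is_seminorm p -> continuous p ->
  exists q : E -> K,
    [/\ is_seminorm q, continuous q, forall x, p x <= q x
      & exists (Bp Bq : completeNormedModType K)
               (jp : {linear E -> Bp}) (jq : {linear E -> Bq})
               (T : {linear Bq -> Bp}),
          [/\ local_banach p jp, local_banach q jq,
              continuous T, forall x, T (jq x) = jp x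
            & nuclear_operator T]].

End Nuclearity.

Section Subspaces.
Variable K : numFieldType.

Definition has_dim (E : lmodType K) (V : set E) (k : nat) :=
  exists e : 'I_k -> E,
    (forall a : 'I_k -> K, \sum_i a i *: e i = 0 -> forall i, a i = 0) /\
    V = [set \sum_i a i *: e i | a in [set: 'I_k -> K]].

Definition linear_span (E : lmodType K) (S : set E) : set E :=
  [set x | exists (n : nat) (a : 'I_n -> K) (s : 'I_n -> E),
     (forall i, S (s i)) /\ x = \sum_i a i *: s i].

Definition closed_span (E : tvsType K) (S : set E) : set E :=
  closure (linear_span S).

Definition complemented (E : tvsType K) (V : set E) :=
  exists P : {linear E -> E},
    [/\ continuous P, forall x, P (P x) = P x & range P = V].

(* Schauder basis of the subspace [V] with the induced topology: unique
   expansions, with continuous coefficient functionals. *)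
Definition schauder_basis (E : tvsType K) (V : set E) (e : nat -> E) :=
  (forall n, V (e n)) /\
  exists c : nat -> E -> K,
    [/\ forall n, {within V, continuous (c n)},
        forall x, V x -> series (fun n => c n x *: e n) @ \oo --> x
      & forall x, V x -> forall a : nat -> K,
          series (fun n => a n *: e n) @ \oo --> x -> forall n, a n = c n x].

Definition has_basis (E : tvsType K) (V : set E) :=
  exists e : nat -> E, schauder_basis V e.

Definition fdd (E : tvsType K) (A : nat -> {linear E -> E}) :=
  [/\ forall n, continuous (A n),
      forall n, exists d : nat, has_dim (range (A n)) d,
      forall m n x, A n (A m x) = if m == n then A n x else 0
    & forall x, series (fun n => A n x) @ \oo --> x].

Definition k_dim_decomposition (k : nat) (E : tvsType K)
    (A : nat -> {linear E -> E}) :=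
  fdd A /\ forall n, has_dim (range (A n)) k.

End Subspaces.

(* Main.v *)
Require Import Defs.
From HB Require Import structures.
From mathcomp Require Import all_boot all_order all_algebra.
From mathcomp Require Import complex.
From mathcomp Require Import boolp classical_sets functions cardinality reals.
From mathcomp Require Import topology normedtype sequences.
From mathcomp Require Import lra.

Import Order.TTheory GRing.Theory Num.Theory.
Import numFieldNormedType.Exports.

Local Open Scope classical_set_scope.
Local Open Scope ring_scope.

Set Implicit Arguments.
Unset Strict Implicit.
Unset Printing Implicit Defensive.

(** Arrange the norms of [E] as an increasing sequence [P_0, P_1, ...].
    Everything rests on finding, in almost all blocks at once, a basis
    [e_0, ..., e_(k-1)] of [E_n] with [e_0 = x_n] that is adapted to all the
    norms: for every [i] there is [j], independent of [n], with
    [|a_h| P_i(e_h) <= P_j(sum_l a_l e_l)] for all coefficients. The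
    coordinate functionals of such a basis, composed with [A_n], give the
    projection onto the span of a subsequence of [x_n] (use only [e_0]) and the
    basis of the span of a subsequence of blocks (use all the [e_h]).

    An adapted basis is built one vector at a time ([adapted_extend]). Given
    adapted [e_0, ..., e_(m-1)] and [z] outside their span, one needs a single
    correction [w] in the span for which [z + w] is nearly as small as possible
    for all norms, up to a change of index ([best_correction]). Let [w_i] be a
    near-optimal correction for [P_i]. Since the [e_h] are adapted, choosing
    [w] splits into [m] problems about scalars: from scalars [t_i] with
    [|t_i - t_l| a_i <= b_l] for [i <= l], where [a] and [b] increase, make one
    scalar [s] with [|s - t_i| a_i <= 3 b_j(i)] for all [i]
    ([scalar_interpolation]). For a cofinal set of indices, discs around the
    [t_i] of radius about [b_j(i) / a_i] are pairwise close, each distance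
    being at most the larger of the two radii; this comes from a dichotomy on
    the growth of [a_l b_l] against [a_i b_j] ([pairwise_close]). The centre of
    the smallest of finitely many such discs then lies in all of them. Passing
    from finitely many conditions to all of them, and all the subsequences
    that the dichotomies call for, are handled by a free ultrafilter on the
    indices [n] ([saturation]); an actual subsequence is extracted once, at the
    end ([extract_subsequence]).

    Nuclearity and completeness provide summability. The [A_n] are
    equicontinuous ([uniform_boundedness]), and nuclearity approximates the
    identity, from one norm to a weaker one, by finite-rank operators
    ([nuclear_finite_rank]); on finitely many vectors [A_n] tends to [0], so
    [P_i(A_n x) <= eps P_j(x)] for large [n], uniformly in [x]
    ([fdd_vanishing]). Along a sparse enough subsequence the chosen basis
    vectors [g_q] and coordinate functionals [c_q] are biorthogonal and satisfy
    [|c_q(x)| P_i(g_q) <= 2^-q P_l(x)]. Then [sum_q c_q(x) g_q] converges and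
    defines a continuous projection onto the closed span of the [g_q], for
    which they are a Schauder basis ([biorthogonal_basis]). *)

(** * Real-valued absolute values on the scalar field *)

Section Scalars.
Variables (R : realType) (K : numFieldType).

Definition cauchy_complete (nrm : K -> R) :=
  forall u : nat -> K,
    (forall e : R, 0 < e -> exists N, forall m n, (N <= m)%N -> (N <= n)%N ->
       nrm (u m - u n) < e) ->
    exists a : K, forall e : R, 0 < e -> exists N, forall n, (N <= n)%N ->
      nrm (u n - a) < e.

(** Treats [R] and [R[i]] alike: the order and the norm of [K] are only used on
    the image of [iota], so all estimates can be made in [R], where the order is
    total and infima exist. *)
Record scalar_modulus (iota : {rmorphism R -> K}) (nrm : K -> R) : Prop :=
  ScalarModulus {
    iota_le : {mono iota : x y / x <= y};
    iota_nrm : forall a, iota (nrm a) = `|a|;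
    scalar_complete : cauchy_complete nrm }.
End Scalars.

Lemma real_cauchy_complete (R : realType) :
  cauchy_complete (fun a : R => `|a|).
Proof.
move=> u uC.
have /cauchy_cvg ucvg : cauchy (u @ \oo).
  apply/cauchy_ballP => e e0; have [N HN] := uC e e0.
  exists ([set u n | n in [set n | (N <= n)%N]],
          [set u n | n in [set n | (N <= n)%N]]) => /=.
    by split; exists N => // n Nn; exists n.
  by move=> [_ _] /= [[m Nm <-] [n Nn <-]]; exact: HN.
exists (lim (u @ \oo)) => e e0.
have /cvgrPdist_lt /(_ e e0) [N _ HN] := ucvg.
by exists N => n Nn; rewrite distrC; exact: HN.
Qed.

Section Complex.
Variable R : realType.
Local Notation modC := (fun z : R[i] => Num.sqrt (complex.Re z ^+ 2 + complex.Im z ^+ 2)).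

Lemma Re_le_modC (z : R[i]) : `|complex.Re z| <= modC z.
Proof. by rewrite -sqrtr_sqr ler_wsqrtr // lerDl sqr_ge0. Qed.

Lemma Im_le_modC (z : R[i]) : `|complex.Im z| <= modC z.
Proof. by rewrite -sqrtr_sqr ler_wsqrtr // lerDr sqr_ge0. Qed.

Lemma modC_le_ReIm (z : R[i]) :
  modC z <= `|complex.Re z| + `|complex.Im z|.
Proof.
rewrite -[leRHS]ger0_norm ?addr_ge0 // -sqrtr_sqr ler_wsqrtr //.
rewrite sqrrD !real_normK ?num_real //.
have := mulr_ge0 (normr_ge0 (complex.Re z)) (normr_ge0 (complex.Im z)); lra.
Qed.

Lemma complex_cauchy_complete : cauchy_complete modC.
Proof.
move=> u uC.
have [|a Ha] := @real_cauchy_complete R (fun n => complex.Re (u n)).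
  move=> e /uC [N HN]; exists N => m n Nm Nn; apply: le_lt_trans (HN m n Nm Nn).
  by apply: le_trans (Re_le_modC _); case: (u m) (u n) => [? ?] [].
have [|b Hb] := @real_cauchy_complete R (fun n => complex.Im (u n)).
  move=> e /uC [N HN]; exists N => m n Nm Nn; apply: le_lt_trans (HN m n Nm Nn).
  by apply: le_trans (Im_le_modC _); case: (u m) (u n) => [? ?] [].
exists (a +i* b)%C => e e0.
have e20 : 0 < e / 2 by lra.
have [N HN] := Ha _ e20; have [N' HN'] := Hb _ e20.
exists (maxn N N') => n; rewrite geq_max => /andP[/HN na /HN' nb].
apply: le_lt_trans (modC_le_ReIm _) _.
by case: (u n) na nb => x y /=; lra.
Qed.
End Complex.

Lemma real_or_complex_modulus (R : realType) (K : numFieldType) :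
  real_or_complex R K ->
  exists (iota : {rmorphism R -> K}) (nrm : K -> R), scalar_modulus iota nrm.
Proof.
case.
  exists idfun, (fun a => `|a|); split=> //; exact: real_cauchy_complete.
exists (real_complex R),
  (fun z : R[i] => Num.sqrt (complex.Re z ^+ 2 + complex.Im z ^+ 2)); split.
- by move=> x y /=; rewrite lecR.
- by move=> z /=; rewrite normc_def.
- exact: complex_cauchy_complete.
Qed.

Section ModulusTheory.
Variables (R : realType) (K : numFieldType).
Variables (iota : {rmorphism R -> K}) (nrm : K -> R).
Hypothesis hK : scalar_modulus iota nrm.

Lemma iota_inj : injective iota.
Proof. exact: fmorph_inj. Qed.

Lemma iota_lt : {mono iota : x y / x < y}.
Proof. by move=> x y; rewrite !lt_neqAle (iota_le hK) (inj_eq iota_inj). Qed.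

Lemma iota_ge0 x : (0 <= iota x) = (0 <= x).
Proof. by rewrite -(rmorph0 iota) (iota_le hK). Qed.

Lemma iota_gt0 x : (0 < iota x) = (0 < x).
Proof. by rewrite -(rmorph0 iota) iota_lt. Qed.

Lemma nrm_ge0 a : 0 <= nrm a.
Proof. by rewrite -iota_ge0 (iota_nrm hK). Qed.

Lemma nrm_id z : 0 <= z -> iota (nrm z) = z.
Proof. by move=> z0; rewrite (iota_nrm hK) ger0_norm. Qed.

Lemma nrm_iota r : 0 <= r -> nrm (iota r) = r.
Proof. by move=> r0; apply: iota_inj; rewrite nrm_id // iota_ge0. Qed.

Lemma nrm0 : nrm 0 = 0.
Proof. by rewrite -(rmorph0 iota) nrm_iota. Qed.

Lemma nrm1 : nrm 1 = 1.
Proof. by rewrite -(rmorph1 iota) nrm_iota. Qed.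

Lemma nrm_eq0 a : nrm a = 0 -> a = 0.
Proof.
by move=> a0; apply/eqP; rewrite -normr_eq0 -(iota_nrm hK) a0 rmorph0.
Qed.

Lemma nrm_gt0 a : (0 < nrm a) = (a != 0).
Proof. by rewrite -iota_gt0 (iota_nrm hK) normr_gt0. Qed.

Lemma nrmN a : nrm (- a) = nrm a.
Proof. by apply: iota_inj; rewrite !(iota_nrm hK) normrN. Qed.

Lemma nrm_dist a b : nrm (a - b) = nrm (b - a).
Proof. by rewrite -nrmN opprB. Qed.

Lemma nrmD a b : nrm (a + b) <= nrm a + nrm b.
Proof. by rewrite -(iota_le hK) rmorphD !(iota_nrm hK) ler_normD. Qed.

Lemma nrm_split a b c : nrm (a - c) <= nrm (a - b) + nrm (b - c).
Proof. by have := nrmD (a - b) (b - c); rewrite addrA subrK. Qed.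

Lemma scalar_pos (e : K) : 0 < e -> exists2 r : R, 0 < r & e = iota r.
Proof.
move=> e0; exists (nrm e); first by rewrite nrm_gt0 gt_eqF.
by rewrite nrm_id // ltW.
Qed.
End ModulusTheory.

(** * Simultaneous choice along a free ultrafilter *)

Section Ultra.
Variables (U : set_system nat).
Context {UU : UltraFilter U}.
Hypothesis Uoo : \oo `<=` U.

Lemma near_below (N : nat) (G : nat -> nat -> Prop) :
  (forall m, (m < N)%N -> \forall n \near U, G m n) ->
  \forall n \near U, forall m, (m < N)%N -> G m n.
Proof.
elim: N => [_|N IH GN]; first by near=> n.
have IH' := IH (fun m mN => GN m (ltnW mN)).
near=> n => m; rewrite ltnS leq_eqVlt => /predU1P[->|mN].
  by near: n; exact: GN.
by move: m mN; near: n.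
Unshelve. all: by end_near. Qed.

Lemma near_not (P : nat -> Prop) :
  ~ (\forall n \near U, P n) -> \forall n \near U, ~ P n.
Proof. by move=> nP; have [//|] := in_ultra_setVsetC [set n | P n] UU. Qed.

(** Countable saturation of ultrapowers: infinitely many conditions can be met
    simultaneously once any finitely many can. At the index [n], the witness
    satisfies the first [n] conditions as far as they are consistent there; the
    longest consistent initial segment grows beyond any bound along [U]. *)
Lemma saturation (Y : Type) (Q : nat -> nat -> Y -> Prop) :
  (forall N, \forall n \near U, exists y, forall m, (m < N)%N -> Q m n y) ->
  exists y : nat -> Y, forall m, \forall n \near U, Q m n (y n).
Proof.
move=> QN.
have [n0 [y0 _]] := filter_ex (QN 0%N).
have step n B : exists y, forall m, (m < B)%N ->
    (exists y', forall m', (m' < m.+1)%N -> Q m' n y') -> Q m n y.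
  elim: B => [|B [y Hy]]; first by exists y0.
  have [[y' Hy']|no] := pselect (exists y', forall m', (m' < B.+1)%N -> Q m' n y').
    by exists y' => m mB _; exact: Hy'.
  exists y => m; rewrite ltnS leq_eqVlt => /predU1P[->|/Hy //].
  by move=> /no.
have [y Hy] := choice (fun n => step n n).
exists y => m; near=> n.
apply: Hy; last by near: n; exact: QN.
by near: n; apply: Uoo; exists m.+1.
Unshelve. all: by end_near. Qed.

End Ultra.

Lemma least_below (R : realType) (r : nat -> R) (N : nat) : (0 < N)%N ->
  exists2 m, (m < N)%N & forall l, (l < N)%N -> r m <= r l.
Proof.
elim: N => // -[_ _|N IH _]; first by exists 0%N => // -[].
have [m mN mr] := IH isT.
have [le|lt] := leP (r m) (r N.+1).
  exists m; first exact: ltnW.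
  by move=> l; rewrite ltnS leq_eqVlt => /predU1P[->|/mr].
exists N.+1 => // l; rewrite ltnS leq_eqVlt => /predU1P[->|/mr] //.
by apply: le_trans; exact: ltW.
Qed.

Section ScalarInterpolation.
Variables (R : realType) (K : numFieldType).
Variables (iota : {rmorphism R -> K}) (nrm : K -> R).
Hypothesis hK : scalar_modulus iota nrm.
Variables (U : set_system nat).
Context {UU : UltraFilter U}.
Hypothesis Uoo : \oo `<=` U.
Variables (a b : nat -> nat -> R) (t : nat -> nat -> K).
Hypothesis a_gt0 : forall i n, 0 < a i n.
Hypothesis b_ge0 : forall i n, 0 <= b i n.
Hypothesis a_mono : forall i j n, (i <= j)%N -> a i n <= a j n.
Hypothesis b_mono : forall i j n, (i <= j)%N -> b i n <= b j n.
Hypothesis t_close : forall i l, (i <= l)%N ->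
  \forall n \near U, nrm (t i n - t l n) * a i n <= b l n.

(** Say that [l] is dominated from [i] when [a_l b_l <= a_i b_j] for some [j].
    If, for some [i0], infinitely many [l] are dominated from [i0], then these
    [l] are used: the distance [b_l / a_i] between the scalars of index [i] and
    [l] is at most [b_j / a_l], the radius of the later index. Otherwise every
    [i] has some [L] beyond it that is not dominated, so that all [b_j] stay
    below [a_L b_L / a_i]; going through the scalar of index [L] shows that all
    later scalars lie within [2 b_L / a_i] of the one of index [i]. *)
Lemma pairwise_close :
  exists sig j : nat -> nat, (forall m, (m <= sig m)%N) /\
    forall m m', \forall n \near U, nrm (t (sig m) n - t (sig m') n) <=
      Num.max (2 * b (j m) n / a (sig m) n) (2 * b (j m') n / a (sig m') n).
Proof.
pose P i l := exists j, \forall n \near U, a l n * b l n <= a i n * b j n.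
suff [sig [j [sig_ge Hsig]]] : exists sig j : nat -> nat,
    (forall m, (m <= sig m)%N) /\
    forall m m', (sig m <= sig m')%N ->
     \forall n \near U, nrm (t (sig m) n - t (sig m') n) * a (sig m) n <= 2 * b (j m) n
      \/ nrm (t (sig m) n - t (sig m') n) * a (sig m') n <= 2 * b (j m') n.
  exists sig, j; split=> // m m'.
  have [le|le] := leqP (sig m) (sig m').
    have Hmm := Hsig _ _ le; near=> n.
    rewrite le_max !ler_pdivlMr //; apply/orP.
    by near: n.
  have Hmm := Hsig _ _ (ltnW le); near=> n.
  rewrite le_max !ler_pdivlMr // (nrm_dist hK); apply/orP.
  by apply/or_comm; near: n.
(* First alternative: infinitely many indices are dominated from [i0]. *)
have [[i0 HA]|HB] := pselect (exists i0, forall L, exists2 l, (L <= l)%N & P i0 l).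
  have /choice[sj Hsj] m : exists sj : nat * nat, (maxn m i0 <= sj.1)%N /\
      \forall n \near U, a sj.1 n * b sj.1 n <= a i0 n * b sj.2 n.
    by have [l lm [j Hj]] := HA (maxn m i0); exists (l, j).
  exists (fun m => (sj m).1), (fun m => (sj m).2); split.
    by move=> m; have [+ _] := Hsj m; rewrite geq_max => /andP[].
  move=> m m' le.
  have [] := Hsj m; rewrite geq_max => /andP[_ im] _.
  have [_ Hm'] := Hsj m'.
  near=> n; right.
  have H1 : nrm (t (sj m).1 n - t (sj m').1 n) * a (sj m).1 n <= b (sj m').1 n.
    by near: n; exact: t_close.
  have H2 : a (sj m').1 n * b (sj m').1 n <= a i0 n * b (sj m').2 n by near: n.
  have H3 : a i0 n * b (sj m').2 n <= a (sj m).1 n * b (sj m').2 n.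
    by rewrite ler_wpM2r ?b_ge0 ?a_mono.
  have : nrm (t (sj m).1 n - t (sj m').1 n) * a (sj m).1 n * a (sj m').1 n <=
     b (sj m').2 n * a (sj m).1 n.
    rewrite [leRHS]mulrC; apply: le_trans H3; apply: le_trans H2.
    by rewrite [leRHS]mulrC ler_wpM2r // ltW // a_gt0.
  rewrite mulrAC ler_pM2r // => /le_trans; apply.
  by have := b_ge0 (sj m').2 n; lra.
(* Second alternative: each [i] has a later index that is not dominated. *)
have /choice[L HL] i : exists L, (i <= L)%N /\ ~ P i L.
  apply: contrapT => no; apply: HB; exists i => L.
  apply: contrapT => noL; apply: no; exists (maxn i L); rewrite leq_maxl; split=> //.
  by move=> PiL; apply: noL; exists (maxn i L) => //; exact: leq_maxr.
exists id, L; split=> // m m' mm'; have [mL nP] := HL m.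
have farB : \forall n \near U, ~ (a (L m) n * b (L m) n <= a m n * b m' n).
  by apply: near_not => near_m'; apply: nP; exists m'.
have [le|lt] := leqP m' (L m).
  near=> n; left; rewrite /=.
  have H1 : nrm (t m n - t m' n) * a m n <= b m' n by near: n; exact: t_close.
  apply: le_trans H1 _; apply: le_trans (b_mono _ le) _.
  by have := b_ge0 (L m) n; lra.
near=> n; left; rewrite /=.
have H2 : nrm (t m n - t (L m) n) * a m n <= b (L m) n.
  by near: n; exact: t_close.
have H3 : nrm (t (L m) n - t m' n) * a (L m) n <= b m' n.
  by near: n; apply: t_close; exact: ltnW.
have H4 : ~ (a (L m) n * b (L m) n <= a m n * b m' n) by near: n.
have {}H4 : a m n * b m' n < a (L m) n * b (L m) n.
  by rewrite ltNge; apply/negP => H; exact: H4 H.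
have H5 : nrm (t (L m) n - t m' n) * a m n <= b (L m) n.
  rewrite -(ler_pM2r (a_gt0 (L m) n)) [leRHS]mulrC.
  apply: le_trans (ltW H4); rewrite mulrAC [leRHS]mulrC.
  by rewrite ler_pM2r.
have := nrm_split hK (t m n) (t (L m) n) (t m' n).
rewrite -(ler_pM2r (a_gt0 m n)); lra.
Unshelve. all: by end_near. Qed.

(** Among finitely many discs whose centres are pairwise within the larger of
    the two radii, the centre of the smallest disc lies in all the others. This
    gives every finite part of the conclusion with constants that do not depend
    on the number of discs, as [saturation] requires. *)
Lemma scalar_interpolation :
  exists s : nat -> K, forall i, exists j,
    \forall n \near U, nrm (s n - t i n) * a i n <= 3 * b j n.
Proof.
have [sig [j [sig_ge Hpair]]] := pairwise_close.
pose r m n := 2 * b (j m) n / a (sig m) n.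
have [] := @saturation U UU Uoo K (fun m n s => nrm (s - t (sig m) n) <= r m n).
  case=> [|N]; first by near=> n; exists 0.
  have Hall : \forall n \near U, forall m, (m < N.+1)%N -> forall m', (m' < N.+1)%N ->
      nrm (t (sig m) n - t (sig m') n) <= Num.max (r m n) (r m' n).
    by apply: near_below => m _; apply: near_below => m' _; exact: Hpair.
  near=> n.
  have [m mN rmin] := least_below (fun m => r m n) (ltn0Sn N).
  exists (t (sig m) n) => l lN.
  have -> : r l n = Num.max (r m n) (r l n) by rewrite max_r // rmin.
  by move: l lN; move: m mN {rmin}; near: n.
move=> s Hs; exists s => i; exists (maxn (j i) (sig i)).
near=> n.
have H1 : nrm (s n - t (sig i) n) * a (sig i) n <= 2 * b (j i) n.
  by rewrite -ler_pdivlMr //; near: n; exact: Hs.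
have H2 : nrm (t i n - t (sig i) n) * a i n <= b (sig i) n.
  by near: n; exact: t_close.
have H3 : nrm (s n - t (sig i) n) * a i n <= 2 * b (j i) n.
  by apply: le_trans H1; rewrite ler_wpM2l ?(nrm_ge0 hK) // a_mono.
have H4 := b_mono n (leq_maxl (j i) (sig i)).
have H5 := b_mono n (leq_maxr (j i) (sig i)).
have := nrm_split hK (s n) (t (sig i) n) (t i n).
rewrite [nrm (t (sig i) n - _)](nrm_dist hK) -(ler_pM2r (a_gt0 i n)); lra.
Unshelve. all: by end_near. Qed.
End ScalarInterpolation.

(** * Indices and linear combinations *)

Section Indices.

Lemma common_index (m : nat) (G : nat -> nat -> Prop) :
  (forall h j j', (j <= j')%N -> G h j -> G h j') ->
  (forall h, (h < m)%N -> exists j, G h j) ->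
  exists j, forall h, (h < m)%N -> G h j.
Proof.
move=> Gup; elim: m => [|m IH] Gm; first by exists 0%N.
have [j Hj] := IH (fun h hm => Gm h (ltnW hm)).
have [j' Hj'] := Gm m (ltnSn m).
exists (maxn j j') => h; rewrite ltnS leq_eqVlt => /predU1P[->|/Hj].
  by apply: Gup Hj'; exact: leq_maxr.
by apply: Gup; exact: leq_maxl.
Qed.

Lemma monotone_choice (G : nat -> nat -> Prop) :
  (forall i j j', (j <= j')%N -> G i j -> G i j') ->
  (forall i, exists j, G i j) ->
  exists phi : nat -> nat,
    [/\ forall i, G i (phi i), forall i, (i <= phi i)%N
      & forall i j, (i <= j)%N -> (phi i <= phi j)%N].
Proof.
move=> Gup /choice[f Hf].
exists (fun i => i + \sum_(l < i.+1) f l)%N; split=> [i|i|i j ij].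
- apply: Gup (Hf i); rewrite big_ord_recr /= addnCA.
  exact: leq_trans (leq_addl _ _) (leq_addl _ _).
- exact: leq_addr.
- apply: leq_add => //; rewrite -!(big_mkord xpredT f).
  by rewrite [leqRHS](big_cat_nat (n := i.+1)) //= leq_addr.
Qed.

End Indices.

Section LinearCombinations.
Variables (K : numFieldType) (E : lmodType K).
Implicit Types (e : nat -> E) (a b : nat -> K).

Definition lincomb m e a : E := \sum_(h < m) a h *: e h.

Definition independent m e :=
  forall a, lincomb m e a = 0 -> forall h, (h < m)%N -> a h = 0.

Lemma lincombS m e a : lincomb m.+1 e a = lincomb m e a + a m *: e m.
Proof. by rewrite /lincomb big_ord_recr. Qed.

Lemma lincombB m e a b :
  lincomb m e a - lincomb m e b = lincomb m e (fun h => a h - b h).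
Proof.
by rewrite /lincomb -sumrB; apply: eq_bigr => h _; rewrite scalerBl.
Qed.

Lemma lincombD m e a b :
  lincomb m e a + lincomb m e b = lincomb m e (fun h => a h + b h).
Proof.
by rewrite /lincomb -big_split; apply: eq_bigr => h _; rewrite /= scalerDl.
Qed.

Lemma lincombZ m e a c : c *: lincomb m e a = lincomb m e (fun h => c * a h).
Proof.
by rewrite /lincomb scaler_sumr; apply: eq_bigr => h _; rewrite scalerA.
Qed.

Lemma eq_lincomb m e e' a a' :
  (forall h, (h < m)%N -> e h = e' h) -> (forall h, (h < m)%N -> a h = a' h) ->
  lincomb m e a = lincomb m e' a'.
Proof. by move=> ee aa; apply: eq_bigr => h _; rewrite ee ?aa. Qed.

Lemma lincomb_delta m e l : (l < m)%N ->
  lincomb m e (fun h => (h == l)%:R) = e l.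
Proof.
move=> lm; rewrite /lincomb (bigD1 (Ordinal lm)) //= eqxx scale1r big1 ?addr0 //.
move=> h hl; suff -> : (h : nat) == l = false by rewrite scale0r.
by apply/negbTE; apply: contraNneq hl => hl; apply/eqP/val_inj.
Qed.

Lemma independent_neq0 m e l : independent m e -> (l < m)%N -> e l != 0.
Proof.
move=> ind lm; apply/eqP => el0.
have := ind (fun h => (h == l)%:R) _ l lm; rewrite lincomb_delta // eqxx => H.
by have /eqP := H el0; rewrite oner_eq0.
Qed.

Lemma independent_inj m e a b : independent m e ->
  lincomb m e a = lincomb m e b -> forall h, (h < m)%N -> a h = b h.
Proof.
move=> ind ab h hm; apply/eqP; rewrite -subr_eq0; apply/eqP.
by apply: (ind (fun h => a h - b h)) => //; rewrite -lincombB ab subrr.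
Qed.

Lemma independentS m e : independent m e ->
  (forall a, e m + lincomb m e a != 0) -> independent m.+1 e.
Proof.
move=> ind nz a; rewrite lincombS => a0.
have am : a m = 0.
  apply: contrapT => /eqP am; have /eqP[] := nz (fun h => (a m)^-1 * a h).
  by rewrite -lincombZ -[e m](scalerK am) -scalerDr addrC a0 scaler0.
move: a0; rewrite am scale0r addr0 => a0 h.
by rewrite ltnS leq_eqVlt => /predU1P[->//|]; exact: ind.
Qed.

Lemma independentS_neq0 m e : independent m.+1 e ->
  forall a, e m + lincomb m e a != 0.
Proof.
move=> ind a; apply/eqP => a0.
have := ind (fun h => if h == m then 1 else a h) _ m (ltnSn m).
rewrite eqxx => H; suff : (1 : K) = 0 by move/eqP; rewrite oner_eq0.
apply: H; rewrite lincombS eqxx scale1r addrC -[RHS]a0; congr (_ + _).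
by apply: eq_lincomb => // h hm; rewrite ltn_eqF.
Qed.

Lemma independentW m e : independent m.+1 e -> independent m e.
Proof.
move=> ind a a0 h hm.
have := ind (fun h => if h == m then 0 else a h) _ h (ltnW hm).
rewrite ltn_eqF //; apply; rewrite lincombS eqxx scale0r addr0 -[RHS]a0.
by apply: eq_lincomb => // l lm; rewrite ltn_eqF.
Qed.

(** The comparison of dimensions in a space without a basis: more than [k]
    combinations of [k] vectors are related, by a kernel vector of their
    coefficient matrix. *)
Lemma independent_le s k (u d : nat -> E) : independent s u ->
  (forall h, (h < s)%N -> exists a, u h = lincomb k d a) -> (s <= k)%N.
Proof.
move=> ind /= Hu; rewrite leqNgt; apply/negP => ks.
have /choice[c Hc] (h : 'I_s) : exists a, u h = lincomb k d a by exact: Hu.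
pose M := \matrix_(h < s, i < k) c h i.
have : kermx M != 0.
  rewrite kermx_eq0 /row_free neq_ltn; apply/orP; left.
  exact: leq_ltn_trans (rank_leq_col _) ks.
case/rowV0Pn => r /sub_kermxP rM /negP[]; apply/eqP/rowP => h.
rewrite mxE.
pose rr i := if insub i is Some j then r 0 (j : 'I_s) else 0.
have rrE (j : 'I_s) : rr j = r 0 j by rewrite /rr valK.
rewrite -rrE; apply: ind => //.
transitivity (\sum_(h < s) \sum_(i < k) (r 0 h * M h i) *: d i).
  apply: eq_bigr => j _; rewrite rrE Hc /lincomb scaler_sumr.
  by apply: eq_bigr => i _; rewrite scalerA mxE.
rewrite exchange_big big1 // => i _; rewrite -scaler_suml.
have /rowP/(_ i) := rM; rewrite !mxE => ->; exact: scale0r.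
Qed.

(** Families indexed by [nat] avoid casts between ordinal types when vectors are
    added one at a time; only the first [k] entries matter. *)
Lemma has_dimP (V : set E) k : has_dim V k ->
  exists d : nat -> E, independent k d /\ V = [set lincomb k d a | a in setT].
Proof.
case: k => [|k] [d [ind ->]].
  exists (fun=> 0); split=> //; apply/seteqP; split=> x [a _ <-].
    by exists (fun=> 0) => //; rewrite /lincomb !big_ord0.
  by exists (fun=> 0) => //; rewrite /lincomb !big_ord0.
exists (d \o inord); split=> [a a0 h hk|].
  rewrite -[h](inordK hk); apply: (ind (fun i => a i)).
  by rewrite -[RHS]a0; apply: eq_bigr => i _; rewrite /= inord_val.
apply/seteqP; split=> x [a _ <-].
  by exists (a \o inord) => //; apply: eq_bigr => i _; rewrite /= inord_val.
by exists (fun i => a i) => //; apply: eq_bigr => i _; rewrite /= inord_val.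
Qed.

End LinearCombinations.

(** * Norms on finite-dimensional subspaces *)

Section FiniteDimension.
Variables (R : realType) (K : numFieldType).
Variables (iota : {rmorphism R -> K}) (nrm : K -> R).
Hypothesis hK : scalar_modulus iota nrm.
Variable (E : lmodType K).

Record real_norm (p : E -> R) : Prop := RealNorm {
  rn_add : forall x y, p (x + y) <= p x + p y;
  rn_scale : forall a x, p (a *: x) = nrm a * p x;
  rn_eq0 : forall x, p x = 0 -> x = 0 }.

Section OneNorm.
Variable p : E -> R.
Hypothesis hp : real_norm p.

Lemma rn0 : p 0 = 0.
Proof. by rewrite -(scale0r 0) (rn_scale hp) (nrm0 hK) mul0r. Qed.

Lemma rnN x : p (- x) = p x.
Proof. by rewrite -scaleN1r (rn_scale hp) (nrmN hK) (nrm1 hK) mul1r. Qed.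

Lemma rn_ge0 x : 0 <= p x.
Proof. by have := rn_add hp x (- x); rewrite subrr rn0 rnN; lra. Qed.

Lemma rn_gt0 x : x != 0 -> 0 < p x.
Proof.
move=> x0; rewrite lt_neqAle rn_ge0 andbT eq_sym.
by apply/eqP => /(rn_eq0 hp)/eqP; exact/negP.
Qed.

Lemma rn_dist x y : p (x - y) = p (y - x).
Proof. by rewrite -rnN opprB. Qed.

Lemma rn_sub x y : p (x - y) <= p x + p y.
Proof. by rewrite -(rnN y); exact: rn_add. Qed.

Lemma rn_split x y z : p (x - z) <= p (x - y) + p (y - z).
Proof. by have := rn_add hp (x - y) (y - z); rewrite addrA subrK. Qed.

Lemma rn_lincomb m e a : p (lincomb m e a) <= \sum_(h < m) nrm (a h) * p (e h).
Proof.
rewrite /lincomb; elim/big_ind2: _ => [|x r y s xr ys|h _].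
- by rewrite rn0.
- by apply: le_trans (rn_add hp _ _) _; exact: lerD.
- by rewrite (rn_scale hp).
Qed.

(** A finite-dimensional subspace is closed. The coefficients of corrections
    [a_l] with [p (z + lincomb m e (a_l))] tending to [0] are Cauchy by the
    lower bound [c], and their limits would express [z] through [e]. Here the
    completeness of the scalar field is indispensable. *)
Lemma dist_span_gt0 m e z (c : R) : 0 < c ->
  (forall a h, (h < m)%N -> c * nrm (a h) <= p (lincomb m e a)) ->
  (forall a, z + lincomb m e a != 0) ->
  exists2 d, 0 < d & forall a, d <= p (z + lincomb m e a).
Proof.
move=> c0 Hc znot; apply: contrapT => no.
have /choice[a Ha] l : exists a, p (z + lincomb m e a) < l.+1%:R^-1.
  apply: contrapT => nol; apply: no; exists l.+1%:R^-1.
    by rewrite invr_gt0 ltr0n.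
  by move=> a; rewrite leNgt; apply/negP => lt; apply: nol; exists a.
have small (e0 : R) : 0 < e0 -> exists N, forall l, (N <= l)%N ->
    p (z + lincomb m e (a l)) < e0.
  move=> e00; exists (Num.bound e0^-1) => l Nl; apply: lt_trans (Ha l) _.
  rewrite invf_plt ?posrE ?ltr0n //.
  apply: lt_le_trans (archi_boundP _) _; first by rewrite invr_ge0 ltW.
  by rewrite ler_nat; exact: leqW.
have /choice[alpha Halpha] h : exists b : K, (h < m)%N ->
    forall e0, 0 < e0 -> exists N, forall l, (N <= l)%N -> nrm (a l h - b) < e0.
  have [hm|] := boolP (h < m)%N; last by exists 0.
  have [|b Hb] := scalar_complete hK (u := fun l => a l h); last by exists b.
  move=> e0 e00; have ce : 0 < c * e0 / 2 by rewrite divr_gt0 ?mulr_gt0.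
  have [N HN] := small _ ce; exists N => l l' /HN Hl /HN Hl'.
  rewrite -(ltr_pM2l c0).
  apply: le_lt_trans (Hc (fun h => a l h - a l' h) _ hm) _.
  rewrite -lincombB.
  have := rn_sub (z + lincomb m e (a l)) (z + lincomb m e (a l')).
  rewrite opprD addrACA subrr add0r; lra.
have /eqP[] := znot alpha; apply: (rn_eq0 hp); apply/eqP.
rewrite eq_le rn_ge0 andbT leNgt; apply/negP => w0.
set w := p _ in w0.
pose S := 1 + \sum_(h < m) p (e h).
have S0 : 0 < S by rewrite ltr_pwDl // sumr_ge0 // => h _; exact: rn_ge0.
have [N HN] := small _ (divr_gt0 w0 S0).
have [N' HN'] : exists N', forall h, (h < m)%N -> forall l, (N' <= l)%N ->
    nrm (a l h - alpha h) < w / S.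
  apply: common_index => [h j j' jj' + l jl|h hm].
    by apply; exact: leq_trans jl.
  exact: (Halpha h hm _ (divr_gt0 w0 S0)).
pose l := maxn N N'.
have H1 := HN l (leq_maxl _ _).
have H2 : p (lincomb m e alpha - lincomb m e (a l)) <= w / S * \sum_(h < m) p (e h).
  rewrite lincombB; apply: le_trans (rn_lincomb _ _ _) _.
  rewrite mulr_sumr; apply: ler_sum => h _.
  rewrite ler_wpM2r ?rn_ge0 // (nrm_dist hK) ltW //.
  by apply: HN' => //; exact: leq_maxr.
have := rn_add hp (z + lincomb m e (a l)) (lincomb m e alpha - lincomb m e (a l)).
rewrite -addrA [lincomb m e (a l) + _]addrC subrK -/w.
have : w / S * S = w by rewrite divfK // gt_eqF.
rewrite {2}/S mulrDr mulr1; lra.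
Qed.

Lemma coef_bound m e : independent m e ->
  exists2 c, 0 < c & forall a h, (h < m)%N -> c * nrm (a h) <= p (lincomb m e a).
Proof.
elim: m => [_|m IH ind]; first by exists 1.
have [c c0 Hc] := IH (independentW ind).
have [d d0 Hd] := dist_span_gt0 c0 Hc (independentS_neq0 ind).
have topP a : d * nrm (a m) <= p (lincomb m.+1 e a).
  have [->|am] := eqVneq (a m) 0; first by rewrite (nrm0 hK) mulr0 rn_ge0.
  rewrite lincombS; have -> : lincomb m e a + a m *: e m =
      a m *: (e m + lincomb m e (fun h => (a m)^-1 * a h)).
    by rewrite -lincombZ scalerDr scalerA divff // scale1r addrC.
  by rewrite (rn_scale hp) mulrC ler_wpM2l ?(nrm_ge0 hK).
pose C := 1 + p (e m) / d.
have C0 : 0 < C by rewrite ltr_pwDl // divr_ge0 ?rn_ge0 // ltW.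
exists (Num.min d (c / C)); first by rewrite lt_min d0 divr_gt0.
move=> a h; rewrite ltnS leq_eqVlt => /predU1P[->|hm].
  apply: le_trans (topP a); rewrite ler_wpM2r ?(nrm_ge0 hK) //.
  by rewrite ge_min lexx.
apply: (@le_trans _ _ (c / C * nrm (a h))).
  by rewrite ler_wpM2r ?(nrm_ge0 hK) // ge_min lexx orbT.
rewrite mulrAC ler_pdivrMr //; apply: le_trans (Hc a h hm) _.
have -> : lincomb m e a = lincomb m.+1 e a - a m *: e m.
  by rewrite lincombS addrK.
apply: le_trans (rn_sub _ _) _; rewrite (rn_scale hp) /C mulrDr mulr1 lerD2l.
rewrite mulrA ler_pdivlMr // mulrAC ler_wpM2r ?rn_ge0 // mulrC; exact: topP.
Qed.

(** Optimal corrections up to a factor [2], which suffices since constants are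
    absorbed by a change of norm; the infimum is positive by [dist_span_gt0]. *)
Lemma near_minimizer m e z : independent m e ->
  (forall a, z + lincomb m e a != 0) ->
  exists a, forall a', p (z + lincomb m e a) <= 2 * p (z + lincomb m e a').
Proof.
move=> ind znot; have [c c0 Hc] := coef_bound ind.
have [d d0 Hd] := dist_span_gt0 c0 Hc znot.
pose S := [set p (z + lincomb m e a) | a in setT].
have Sinf : has_inf S.
  split; first by exists (p (z + lincomb m e (fun=> 0))), (fun=> 0).
  by exists d => _ [a _ <-].
have dS : d <= inf S by apply: lb_le_inf; [case: Sinf|move=> _ [a _ <-]].
have [_ [a _ <-] Ha] := inf_adherent (lt_le_trans d0 dS) Sinf.
exists a => a'; have : inf S <= p (z + lincomb m e a').
  by apply: ge_inf; [case: Sinf|exists a'].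
lra.
Qed.

End OneNorm.
End FiniteDimension.

Section GradedNorms.
Variables (R : realType) (K : numFieldType).
Variables (iota : {rmorphism R -> K}) (nrm : K -> R).
Hypothesis hK : scalar_modulus iota nrm.
Variable (E : lmodType K).

(** The factor [2] lets the index absorb every multiplicative constant (see
    [gn_absorb]): estimates that hold up to a constant and a change of norm then
    hold up to a change of norm alone, with an index that can be the same for
    almost all blocks. *)
Record graded_norms (P : nat -> E -> R) : Prop := GradedNorms {
  gn_norm : forall i, real_norm nrm (P i);
  gn_double : forall i x, 2 * P i x <= P i.+1 x }.

Variable P : nat -> E -> R.
Hypothesis hP : graded_norms P.

Lemma gn_ge0 i x : 0 <= P i x.
Proof. exact: (rn_ge0 hK (gn_norm hP i)). Qed.

Lemma gn_power i m x : 2 ^+ m * P i x <= P (i + m) x.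
Proof.
elim: m => [|m IH]; first by rewrite expr0 mul1r addn0.
rewrite exprS -mulrA addnS; apply: le_trans (gn_double hP _ _).
by rewrite ler_pM2l.
Qed.

Lemma gn_mono i j x : (i <= j)%N -> P i x <= P j x.
Proof.
move=> ij; rewrite -(subnKC ij); apply: le_trans (gn_power _ _ _).
by rewrite ler_peMl ?gn_ge0 // exprn_ege1 // ler1n.
Qed.

Lemma gn_absorb i (C : R) : exists2 j, (i <= j)%N & forall x, C * P i x <= P j x.
Proof.
have [C0|/ltW C0] := leP 0 C; last first.
  exists i => // x; apply: le_trans (gn_ge0 i x).
  by rewrite mulr_le0_ge0 ?gn_ge0.
exists (i + Num.bound C)%N; first exact: leq_addr.
move=> x; apply: le_trans (gn_power _ _ _); rewrite ler_wpM2r ?gn_ge0 //.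
by rewrite ltW // upper_nthrootP.
Qed.

End GradedNorms.

(** * Bases adapted to all the norms *)

Section Adapted.
Variables (R : realType) (K : numFieldType).
Variables (iota : {rmorphism R -> K}) (nrm : K -> R).
Hypothesis hK : scalar_modulus iota nrm.
Variable (E : lmodType K) (P : nat -> E -> R).
Hypothesis hP : graded_norms nrm P.
Variables (U : set_system nat).
Context {UU : UltraFilter U}.
Hypothesis Uoo : \oo `<=` U.

Let Pn i := gn_norm hP i.

(** The family varies with [n]; the index [j] must not. *)
Definition adapted m (e : nat -> nat -> E) :=
  forall i, exists j, \forall n \near U, forall a h, (h < m)%N ->
    nrm (a h) * P i (e h n) <= P j (lincomb m (e^~ n) a).

(** With [al i n] the coefficients of a near-optimal correction for [P i], two
    such corrections differ by at most the distance of the larger index. As [e]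
    is adapted, this bounds the differences of each coefficient, and
    [scalar_interpolation] merges the corrections coefficient by coefficient. *)
Lemma best_correction m (e : nat -> nat -> E) (z : nat -> E) :
  (forall n, independent m (e^~ n)) -> adapted m e ->
  (forall n a, z n + lincomb m (e^~ n) a != 0) ->
  exists s : nat -> nat -> K, forall i, exists j, \forall n \near U, forall a,
    P i (z n + lincomb m (e^~ n) (s^~ n)) <= P j (z n + lincomb m (e^~ n) a).
Proof.
move=> ind ade znot.
have /choice[al Hal] i : exists al : nat -> nat -> K, forall n a,
    P i (z n + lincomb m (e^~ n) (al n)) <= 2 * P i (z n + lincomb m (e^~ n) a).
  have /choice[al Hal] n : exists aln : nat -> K, forall a,
      P i (z n + lincomb m (e^~ n) aln) <= 2 * P i (z n + lincomb m (e^~ n) a).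
    exact: (near_minimizer hK (Pn i) (ind n) (znot n)).
  by exists al.
pose b i n := P i (z n + lincomb m (e^~ n) (al i n)).
have b_ge0 i n : 0 <= b i n by exact: (gn_ge0 hK hP).
have b_mono i j n : (i <= j)%N -> b i n <= b j n.
  rewrite leq_eqVlt => /predU1P[->//|ij].
  apply: le_trans (Hal i n (al j n)) _.
  exact: le_trans (gn_double hP _ _) (gn_mono hK hP _ ij).
(* [phi] is the loss of index in the adaptedness of [e]; the interpolated
   corrections are those of index [phi i]. *)
have [phi [Hphi phi_ge phi_mono]] := monotone_choice (G := fun i j =>
    \forall n \near U, forall a h, (h < m)%N ->
      nrm (a h) * P i (e h n) <= P j (lincomb m (e^~ n) a))
  (fun i j j' jj' Gij => filterS (fun n H a h hm =>
      le_trans (H a h hm) (gn_mono hK hP _ jj')) Gij) ade.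
have /choice[s Hs] h : exists s : nat -> K, (h < m)%N -> forall i, exists j,
    \forall n \near U, nrm (s n - al (phi i) n h) * P i (e h n) <= 6 * b j n.
  have [hm|] := boolP (h < m)%N; last by exists (fun=> 0).
  have [|||||s Hs] := scalar_interpolation hK Uoo (a := fun i n => P i (e h n))
    (b := fun i n => 2 * b (phi i) n) (t := fun i n => al (phi i) n h).
  - move=> i n; apply: (rn_gt0 hK (Pn i)).
    exact: (independent_neq0 (ind n) hm).
  - by move=> i n; rewrite mulr_ge0.
  - by move=> i j n ij; exact: (gn_mono hK hP).
  - by move=> i j n ij; rewrite ler_wpM2l // b_mono // phi_mono.
  - move=> i l il; near=> n.
    have H1 : nrm (al (phi i) n h - al (phi l) n h) * P i (e h n) <=
       P (phi i) (lincomb m (e^~ n) (fun h => al (phi i) n h - al (phi l) n h)).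
      have H : forall a h, (h < m)%N ->
          nrm (a h) * P i (e h n) <= P (phi i) (lincomb m (e^~ n) a).
        by near: n; exact: Hphi.
      exact: (H (fun h => al (phi i) n h - al (phi l) n h)).
    apply: le_trans H1 _; rewrite -lincombB.
    have := rn_sub hK (Pn (phi i)) (z n + lincomb m (e^~ n) (al (phi i) n))
      (z n + lincomb m (e^~ n) (al (phi l) n)).
    rewrite opprD addrACA subrr add0r -/(b _ _) => /le_trans; apply.
    have := b_mono _ _ n (phi_mono _ _ il).
    have : P (phi i) (z n + lincomb m (e^~ n) (al (phi l) n)) <= b (phi l) n.
      by apply: (gn_mono hK hP); exact: phi_mono.
    lra.
  - exists s => _ i; have [j Hj] := Hs i; exists (phi j); near=> n.
    apply: (@le_trans _ _ (3 * (2 * b (phi j) n))); first by near: n.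
    by rewrite mulrA -natrM.
exists s => i.
have [j Hj] := common_index (m := m) (G := fun h j =>
    \forall n \near U, nrm (s h n - al (phi i) n h) * P i (e h n) <= 6 * b j n)
  (fun h j j' jj' Gj => filterS (fun n H => le_trans H
    (ler_wpM2l (ler0n R 6) (b_mono _ _ n jj'))) Gj) (fun h hm => Hs h hm i).
(* The factor collects one near-optimality constant, the correction of index
   [phi i], and [6] for each of the [m] coefficients. *)
pose J := maxn (phi i) j.
have [j' _ Hj'] := gn_absorb hK hP J (2 * (1 + 6 * m%:R)).
exists j'.
have near_all := near_below Hj.
near=> n => a.
have Hs_n : forall h, (h < m)%N ->
    nrm (s h n - al (phi i) n h) * P i (e h n) <= 6 * b j n.
  by near: n; exact: near_all.
apply: le_trans (Hj' _); rewrite mulrAC.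
have HJ : b J n <= 2 * P J (z n + lincomb m (e^~ n) a) by exact: Hal.
apply: le_trans (ler_wpM2r _ HJ); last by rewrite addr_ge0 // mulr_ge0.
have -> : z n + lincomb m (e^~ n) (s^~ n) = z n + lincomb m (e^~ n) (al (phi i) n)
    + (lincomb m (e^~ n) (s^~ n) - lincomb m (e^~ n) (al (phi i) n)).
  by rewrite -addrA [lincomb _ _ (al _ _) + _]addrC subrK.
apply: le_trans (rn_add (Pn i) _ _) _; rewrite mulrDr mulr1; apply: lerD.
  apply: le_trans (gn_mono hK hP _ (phi_ge i)) _.
  by apply: b_mono; exact: leq_maxl.
rewrite lincombB; apply: le_trans (rn_lincomb hK (Pn i) _ _ _) _.
apply: (@le_trans _ _ (\sum_(h < m) 6 * b J n)); last first.
  by rewrite sumr_const card_ord -[_ *+ m]mulr_natr (mulrC 6) -mulrA.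
apply: ler_sum => h _; apply: (@le_trans _ _ (6 * b j n)).
  exact: Hs_n.
by rewrite ler_pM2l // b_mono // leq_maxr.
Unshelve. all: by end_near. Qed.

(** The last coordinate of a combination is controlled because [z + w] is nearly
    minimal in its class modulo the span; the other coordinates follow by
    subtracting the last term. *)
Lemma adapted_extend m (e : nat -> nat -> E) (z : nat -> E) :
  (forall n, independent m (e^~ n)) -> adapted m e ->
  (forall n a, z n + lincomb m (e^~ n) a != 0) ->
  exists s : nat -> nat -> K,
    let e' := fun h n => if (h < m)%N then e h n
                         else z n + lincomb m (e^~ n) (s^~ n) in
    (forall n, independent m.+1 (e'^~ n)) /\ adapted m.+1 e'.
Proof.
move=> ind ade znot; have [s Hs] := best_correction ind ade znot.
exists s; set e' := fun h n => _; rewrite /=.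
have e'E n a : lincomb m (e'^~ n) a = lincomb m (e^~ n) a.
  by apply: eq_lincomb => // h hm; rewrite /e' hm.
have e'm n : e' m n = z n + lincomb m (e^~ n) (s^~ n) by rewrite /e' ltnn.
split=> [n|i].
  apply: independentS => [a|a]; first by rewrite e'E; exact: ind.
  by rewrite e'E e'm -addrA lincombD.
have [j Hj] := ade i; have [j1 Hj1] := Hs j; have [j2 Hj2] := Hs i.
pose j0 := maxn j (maxn j1 j2).
have [j3 _ Hj3] := gn_absorb hK hP j0 2.
exists j3; near=> n => a h.
have top i' j' : (forall c, P i' (z n + lincomb m (e^~ n) (s^~ n)) <=
      P j' (z n + lincomb m (e^~ n) c)) ->
    nrm (a m) * P i' (e' m n) <= P j' (lincomb m.+1 (e'^~ n) a).
  move=> H; have [->|am] := eqVneq (a m) 0.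
    by rewrite (nrm0 hK) mul0r (gn_ge0 hK hP).
  rewrite lincombS e'E e'm; set sn := s^~ n in H *.
  have -> : lincomb m (e^~ n) a + a m *: (z n + lincomb m (e^~ n) sn) =
      a m *: (z n + lincomb m (e^~ n) (fun h => sn h + (a m)^-1 * a h)).
    rewrite -lincombD -lincombZ addrA [in RHS]scalerDr scalerA divff // scale1r.
    exact: addrC.
  by rewrite (rn_scale (Pn j')) ler_wpM2l ?(nrm_ge0 hK).
have T1 : nrm (a m) * P j (e' m n) <= P j1 (lincomb m.+1 (e'^~ n) a).
  by apply: top; near: n.
have T2 : nrm (a m) * P i (e' m n) <= P j2 (lincomb m.+1 (e'^~ n) a).
  by apply: top; near: n.
have Pup x : P j x <= P j0 x /\ P j1 x <= P j0 x /\ P j2 x <= P j0 x.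
  split; [|split]; apply: (gn_mono hK hP); rewrite /j0 !leq_max ?leqnn ?orbT //.
have B : forall a h, (h < m)%N ->
    nrm (a h) * P i (e h n) <= P j (lincomb m (e^~ n) a) by near: n.
have [U0 [U1 U2]] := Pup (lincomb m.+1 (e'^~ n) a).
have y0 := gn_ge0 hK hP j0 (lincomb m.+1 (e'^~ n) a).
rewrite ltnS leq_eqVlt => /predU1P[->|hm]; apply: le_trans (Hj3 _).
  by move: T2 U2 y0; lra.
have -> : e' h n = e h n by rewrite /e' hm.
apply: le_trans (B a h hm) _.
have -> : lincomb m (e^~ n) a = lincomb m.+1 (e'^~ n) a - a m *: e' m n.
  by rewrite lincombS e'E addrK.
apply: le_trans (rn_sub hK (Pn j) _ _) _; rewrite (rn_scale (Pn j)).
by move: T1 U0 U1; lra.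
Unshelve. all: by end_near. Qed.

(** Extending by one vector at a time, starting from [x]. Dimension counts
    provide a new vector outside the span as long as fewer than [k] have been
    chosen, and show that [k] of them span. *)
Theorem adapted_basis k (V : nat -> set E) (x : nat -> E) :
  (0 < k)%N -> (forall n, has_dim (V n) k) ->
  (forall n, V n (x n)) -> (forall n, x n != 0) ->
  exists e : nat -> nat -> E,
    [/\ forall n, e 0%N n = x n,
        forall n, independent k (e^~ n),
        forall n, V n = [set lincomb k (e^~ n) a | a in setT]
      & adapted k e].
Proof.
case: k => // k _ Vdim Vx xnz.
have /choice[d Hd] n := has_dimP (Vdim n).
have Vlin n m (f : nat -> E) a : (forall h, (h < m)%N -> V n (f h)) ->
    V n (lincomb m f a).
  have [_ ->] := Hd n; elim: m => [_|m IH Hf].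
    exists (fun=> 0) => //; rewrite /lincomb big_ord0 big1 // => i _.
    by rewrite scale0r.
  have [c _ Hc] := IH (fun h hm => Hf h (ltnW hm)).
  have [c' _ Hc'] := Hf m (ltnSn m).
  by exists (fun h => c h + a m * c' h) => //; rewrite [in RHS]lincombS -Hc -Hc' lincombZ lincombD.
suff H m : (m <= k)%N -> exists e : nat -> nat -> E,
    [/\ forall n, e 0%N n = x n, forall n, independent m.+1 (e^~ n),
        forall n h, (h < m.+1)%N -> V n (e h n) & adapted m.+1 e].
  have [e [e0 ind Ve ade]] := H k (leqnn k); exists e; split=> // n.
  apply/seteqP; split=> [y Vy|_ [a _ <-]]; last by apply: Vlin; exact: Ve.
  apply: contrapT => ynot.
  have : independent k.+2 (fun h => if (h < k.+1)%N then e h n else y).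
    apply: independentS => [a a0|a].
      apply: (ind n); rewrite -[RHS]a0.
      by apply: eq_lincomb => // h ->.
    rewrite ltnn; apply/eqP => ya; apply: ynot.
    exists (fun h => - 1 * a h) => //; rewrite -lincombZ scaleN1r; apply/eqP.
    rewrite eq_sym -subr_eq0 opprK -[X in _ == X]ya; apply/eqP; congr (_ + _).
    by apply: eq_lincomb => // h ->.
  have [_ VE] := Hd n; move/(independent_le (k := k.+1) (d := d n)) => H'.
  suff : (k.+2 <= k.+1)%N by rewrite ltnn.
  apply: H' => h _; have : V n (if (h < k.+1)%N then e h n else y).
    by case: ifP => // /Ve.
  by rewrite VE => -[a _ <-]; exists a.
elim: m => [_|m IH mk].
  exists (fun=> x); split=> // [n a|i].
  - rewrite /lincomb big_ord1 /= => /eqP; rewrite scaler_eq0 (negPf (xnz n)) orbF.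
    by move=> /eqP a0 [].
  - exists i; near=> n => a h; rewrite ltnS leqn0 => /eqP ->.
    by rewrite /lincomb big_ord1 (rn_scale (Pn i)).
have [e [e0 ind Ve ade]] := IH (ltnW mk).
have /choice[z Hz] n : exists z, V n z /\ forall a, z + lincomb m.+1 (e^~ n) a != 0.
  apply: contrapT => no; have [dind VE] := Hd n.
  suff : (k.+1 <= m.+1)%N by rewrite ltnS leqNgt mk.
  apply: (independent_le (u := d n) (d := e^~ n)) => // h hk.
  apply: contrapT => noh; apply: no; exists (d n h); split.
    rewrite VE; exists (fun l => (l == h)%:R) => //.
    exact: lincomb_delta.
  move=> a; apply/eqP => da; apply: noh; exists (fun l => - 1 * a l).
  by rewrite -lincombZ scaleN1r; apply/eqP; rewrite -subr_eq0 opprK da.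
have [s [/= ind' ade']] := adapted_extend ind ade (fun n => (Hz n).2).
exists (fun h n => if (h < m.+1)%N then e h n
                   else z n + lincomb m.+1 (e^~ n) (s^~ n)); split=> //.
move=> n h _; case: ifP => [|_]; first exact: Ve.
have -> : z n + lincomb m.+1 (e^~ n) (s^~ n) = lincomb m.+2
    (fun h => if (h < m.+1)%N then e h n else z n)
    (fun h => if (h < m.+1)%N then s h n else 1).
  rewrite [in RHS]lincombS ltnn scale1r addrC; congr (_ + _).
  by apply: eq_lincomb => l ->.
by apply: Vlin => l _; case: ifP => [/Ve//|_]; have [] := Hz n.
Unshelve. all: by end_near. Qed.

End Adapted.

(** * The topology given by a graded sequence of norms *)

Section GradedTopology.
Variables (R : realType) (K : numFieldType).
Variables (iota : {rmorphism R -> K}) (nrm : K -> R).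
Hypothesis hK : scalar_modulus iota nrm.

Definition graded_topology (E : tvsType K) (P : nat -> E -> R) :=
  forall (x : E) (V : set E), nbhs x V <->
    exists i e, 0 < e /\ [set y | P i (y - x) < e] `<=` V.

(** The grading is [P i = 2 ^ i * (p 0 + ... + p i)]. *)
Lemma countably_normed_graded (E : tvsType K) : countably_normed E ->
  exists2 P : nat -> E -> R, graded_norms nrm P & graded_topology P.
Proof.
move=> [p [pnorm _ pnbhs]].
pose q i x := nrm (p i x).
have qE i x : iota (q i x) = p i x.
  by apply: (nrm_id hK); have [[]] := pnorm i.
have q_ge0 i x : 0 <= q i x by exact: nrm_ge0 hK _.
have q_add i x y : q i (x + y) <= q i x + q i y.
  by rewrite -(iota_le hK) rmorphD !qE; have [[]] := pnorm i.
have q_scale i a x : q i (a *: x) = nrm a * q i x.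
  by apply: (fmorph_inj iota); rewrite rmorphM !qE (iota_nrm hK); have [[]] := pnorm i.
have q_eq0 i x : q i x = 0 -> x = 0.
  by move=> qx; have [_] := pnorm i; apply; rewrite -qE qx rmorph0.
pose P i x : R := 2 ^+ i * \sum_(l < i.+1) q l x.
have two_gt0 i : 0 < 2 ^+ i :> R by rewrite exprn_gt0.
have qP i l x : (l <= i)%N -> q l x <= P i x.
  move=> li; apply: (@le_trans _ _ (\sum_(l < i.+1) q l x)).
    rewrite -ltnS in li; rewrite (bigD1 (Ordinal li)) //= lerDl.
    by apply: sumr_ge0.
  by rewrite ler_peMl ?sumr_ge0 // exprn_ege1 // ler1n.
exists P.
  split=> [i|i x]; first split.
  - move=> x y; rewrite -mulrDr ler_pM2l // -big_split /=.
    by apply: ler_sum => l _; exact: q_add.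
  - move=> a x; rewrite /P mulrCA; congr (_ * _); rewrite mulr_sumr.
    by apply: eq_bigr => l _; exact: q_scale.
  - move=> x Px; apply: (q_eq0 0%N); apply/eqP; rewrite eq_le q_ge0 andbT.
    by rewrite -Px; exact: qP.
  - rewrite /P exprS mulrA ler_pM2l ?mulr_gt0 //.
    by rewrite [leRHS]big_ord_recr lerDl.
move=> x V; rewrite pnbhs; split=> [[N [e [e0 HV]]]|[i [e [e0 HV]]]].
  have [r r0 er] := scalar_pos hK e0.
  exists N, r; split=> // y /= Py; apply: HV => l lN.
  rewrite er -qE (iota_lt hK); apply: le_lt_trans Py; apply: qP; exact: ltnW.
pose d := e / (2 * (2 ^+ i * i.+1%:R)).
have d0 : 0 < d by rewrite divr_gt0 // !mulr_gt0 // ltr0n.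
exists i.+1, (iota d); rewrite (iota_gt0 hK); split=> // y Hy; apply: HV => /=.
apply: (@le_lt_trans _ _ (2 ^+ i * \sum_(l < i.+1) d)).
  rewrite ler_pM2l //; apply: ler_sum => l _; apply: ltW.
  by rewrite -(iota_lt hK) qE; exact: Hy.
rewrite sumr_const card_ord -[d *+ _]mulr_natr mulrCA /d.
have m0 : 2 ^+ i * i.+1%:R != 0 :> R by rewrite mulf_neq0 ?gt_eqF // ltr0n.
have cancelM (M : R) : M != 0 -> e / (2 * M) * M = e / 2.
  by move=> M0; rewrite invfM mulrA divfK.
rewrite cancelM //; lra.
Qed.

Variables (E : tvsType K) (P : nat -> E -> R).
Hypothesis hP : graded_norms nrm P.
Hypothesis hT : graded_topology P.

Let Pn i := gn_norm hP i.

Lemma graded_ball i (x : E) e : 0 < e -> nbhs x [set y | P i (y - x) < e].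
Proof. by move=> e0; apply/hT; exists i, e; split. Qed.

Lemma cvg_graded (u : nat -> E) x : u @ \oo --> x <->
  forall i e, 0 < e -> exists N, forall n, (N <= n)%N -> P i (u n - x) < e.
Proof.
split=> [ux i e e0|ux V /hT[i [e [e0 HV]]]].
  have : nbhs x [set y | P i (y - x) < e] by exact: graded_ball.
  by move=> /ux[N _ HN]; exists N.
by have [N HN] := ux i e e0; exists N => // n /HN; exact: HV.
Qed.

Lemma graded_eq x y : (forall e, 0 < e -> P 0%N (x - y) <= e) -> x = y.
Proof.
move=> H; apply/eqP; rewrite -subr_eq0; apply/eqP/(rn_eq0 (Pn 0)).
apply/eqP; rewrite eq_le (gn_ge0 hK hP) andbT.
by apply/ler_addgt0Pl => e e0; rewrite addr0; exact: H.
Qed.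

Lemma cvg_graded_unique (u : nat -> E) (x y : E) :
  u @ \oo --> x -> u @ \oo --> y -> x = y.
Proof.
move=> /(cvg_graded u x) ux /(cvg_graded u y) uy; apply: graded_eq => e e0.
have e2 : 0 < e / 2 by lra.
have [N HN] := ux 0%N _ e2; have [N' HN'] := uy 0%N _ e2.
have := HN _ (leq_maxl N N'); have := HN' _ (leq_maxr N N').
have := rn_split (Pn 0) x (u (maxn N N')) y.
rewrite (rn_dist hK (Pn 0) x (u _)); lra.
Qed.

Lemma closure_graded (V : set E) x : closure V x <->
  forall i e, 0 < e -> exists2 v, V v & P i (v - x) < e.
Proof.
split=> [Vx i e e0|Vx B /hT[i [e [e0 HB]]]].
  have /Vx[v [Vv Hv]] : nbhs x [set y | P i (y - x) < e].
    exact: graded_ball.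
  by exists v.
by have [v Vv /HB Bv] := Vx i e e0; exists v.
Qed.

Lemma cauchy_graded : complete_tvs E -> forall u : nat -> E,
  (forall i e, 0 < e -> exists N, forall m n, (N <= m)%N -> (N <= n)%N ->
     P i (u m - u n) < e) -> exists x : E, u @ \oo --> x.
Proof.
move=> hE u uC; apply: hE => V /hT[i [e [e0 HV]]].
have [N HN] := uC i e e0.
exists [set u n | n in [set n | (N <= n)%N]].
  by exists N => // n Nn; exists n.
by move=> _ _ [m Nm <-] [n Nn <-]; apply: HV; rewrite /= subr0; exact: HN.
Qed.

(** For homogeneous functions, boundedness on a neighbourhood of [0] is an
    estimate by one of the norms. *)
Lemma gauge_bound (q : E -> R) :
  (forall a x, q (a *: x) = nrm a * q x) ->
  nbhs 0 [set x | q x < 1] -> exists j, forall x, q x <= P j x.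
Proof.
move=> qZ /hT[j [e [e0 He]]]; have [j' _ Hj'] := gn_absorb hK hP j (2 / e).
have q0 : q 0 = 0 by rewrite -(scale0r 0) qZ (nrm0 hK) mul0r.
exists j' => x; apply: le_trans (Hj' x).
have [->|x0] := eqVneq x 0.
  by rewrite q0 mulr_ge0 ?divr_ge0 ?(gn_ge0 hK hP) // ltW.
have Px := rn_gt0 hK (Pn j) x0.
pose r := e / (2 * P j x); have r0 : 0 < r by rewrite divr_gt0 ?mulr_gt0.
have : q (iota r *: x) < 1.
  apply: He => /=; rewrite subr0 (rn_scale (Pn j)) (nrm_iota hK) ?(ltW r0) //.
  have -> : r * P j x = e / 2 by rewrite /r invfM mulrA divfK ?gt_eqF.
  lra.
rewrite qZ (nrm_iota hK) ?(ltW r0) // -ltr_pdivlMl // mulr1 => /ltW.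
by rewrite /r invf_div mulrAC.
Qed.

Lemma linear_bounded (f : {linear E -> E}) : continuous f ->
  forall i, exists j, forall x, P i (f x) <= P j x.
Proof.
move=> fc i; apply: gauge_bound => [a x|].
  by rewrite linearZ (rn_scale (Pn i)).
suff /(fc 0) : nbhs (f 0) [set y | P i y < 1] by [].
rewrite linear0; apply/hT; exists i, 1; split=> // y /=.
by rewrite subr0.
Qed.

Lemma bounded_continuous (f : {linear E -> E}) :
  (forall i, exists j, forall x, P i (f x) <= P j x) -> continuous f.
Proof.
move=> fb x V /hT[i [e [e0 HV]]]; have [j Hj] := fb i.
apply/hT; exists j, e; split=> // y Hy; apply: HV; rewrite /= -linearB.
exact: le_lt_trans (Hj _) Hy.
Qed.

Lemma bounded_functional_continuous (c : E -> K) :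
  (forall x y, c (x - y) = c x - c y) ->
  (exists j, forall x, nrm (c x) <= P j x) -> continuous c.
Proof.
move=> cB [j Hj] x; apply/cvgrPdist_lt => e e0.
have [r r0 er] := scalar_pos hK e0.
have : nbhs x [set y | P j (y - x) < r] by exact: graded_ball.
apply: filterS => y /= Hy.
rewrite er -cB -(iota_nrm hK) (iota_lt hK).
by apply: le_lt_trans (Hj _) _; rewrite (rn_dist hK (Pn j)).
Qed.

Lemma graded_seminorm i : is_seminorm (iota \o P i) /\ continuous (iota \o P i).
Proof.
split.
  split=> [x|x y|a x] /=.
  - by rewrite (iota_ge0 hK) (gn_ge0 hK hP).
  - by rewrite -rmorphD (iota_le hK) (rn_add (Pn i)).
  - by rewrite (rn_scale (Pn i)) rmorphM (iota_nrm hK).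
move=> x; apply/cvgrPdist_lt => e e0.
have [r r0 er] := scalar_pos hK e0.
have : nbhs x [set y | P i (y - x) < r] by exact: graded_ball.
apply: filterS => y /= Hy.
rewrite er -rmorphB -(iota_nrm hK) (iota_lt hK).
have abs (s t : R) : 0 <= s -> `|s| <= t -> s <= t by move=> s0; rewrite ger0_norm.
have nR (s : R) : nrm (iota s) = `|s|.
  have [s0|s0] := leP 0 s; first by rewrite (nrm_iota hK) // ger0_norm.
  by rewrite -(nrmN hK) -rmorphN (nrm_iota hK) ?ltr0_norm // oppr_ge0 ltW.
rewrite nR; apply: le_lt_trans Hy; rewrite ler_norml.
have := rn_split (Pn i) x y 0; have := rn_split (Pn i) y x 0.
rewrite !subr0 (rn_dist hK (Pn i) x y) => H1 H2; apply/andP; split; lra.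
Qed.

(** Truncate the nuclear expansion of the linking map between two local Banach
    spaces, and replace the vectors of the completion that occur in it by nearby
    elements of [E]. *)
Lemma nuclear_finite_rank : nuclear_space E -> forall i, exists j, forall eps : R,
  0 < eps -> exists N (g : nat -> E -> K) (v : nat -> E),
    (forall m x, nrm (g m x) <= P j x) /\
    forall x, P i (x - \sum_(m < N) g m x *: v m) <= eps * P j x.
Proof.
move=> nucE i; have [psemi pcont] := graded_seminorm i.
have [q [[q_ge0 q_add q_scale] qcont _ [Bp [Bq [jp [jq [T]]]]]]] := nucE _ psemi pcont.
move=> [[jpE jp_dense] [jqE _] _ Tj [l [f [y [lsum f_le y_le Tsum]]]]].
have [j Hj] : exists j, forall x, nrm (q x) <= P j x.
  apply: gauge_bound => [a x|].
    by apply: (fmorph_inj iota); rewrite rmorphM (iota_nrm hK a) !(nrm_id hK) //.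
  have q0 : q 0 = 0 by rewrite -(scale0r 0) q_scale normr0 mul0r.
  have /cvgrPdist_lt /(_ 1 ltr01) := qcont 0; rewrite q0.
  apply: filterS => x /=; rewrite sub0r normrN -(iota_nrm hK).
  by rewrite -(rmorph1 iota) (iota_lt hK).
have Hj' x : q x <= iota (P j x) by rewrite -(nrm_id hK (q_ge0 x)) (iota_le hK).
exists j => eps eps0.
have h0 : 0 < iota (eps / 2) by rewrite (iota_gt0 hK) divr_gt0.
have [N HN] : exists N, forall n, (N <= n)%N -> \sum_(N <= m < n) `|l m| <= iota (eps / 2).
  have /cvg_cauchy/cauchy_seriesP/(_ _ h0) [[A B] /= [[N1 _ HA] [N2 _ HB]] H] := lsum.
  exists (maxn N1 N2) => n Nn; rewrite -[leLHS]ger0_norm ?sumr_ge0 // ltW //.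
  apply: (H (maxn N1 N2, n)); split; [apply: HA; exact: leq_maxl|apply: HB].
  by apply: leq_trans Nn; exact: leq_maxr.
pose L := \sum_(m < N) `|l m|.
have L0 : 0 <= L by exact: sumr_ge0.
have L1 : 0 < 1 + L by rewrite ltr_pwDl.
pose eta := iota (eps / 2) / (1 + L).
have eta0 : 0 < eta by rewrite divr_gt0.
have /choice[w Hw] m : exists w : E, `|y m - jp w| < eta.
  have [] := jp_dense (ball (y m) eta) _ (ball_open _ _).
    by exists (y m); exact: ballxx.
  by move=> b [yb [w _ wb]]; exists w; rewrite wb; move: yb; rewrite -ball_normE.
exists N, (fun m x => f m (jq x)), (fun m => l m *: w m); split=> [m x|x].
  rewrite -(iota_le hK) (iota_nrm hK); apply: le_trans (f_le _ _) _.
  by rewrite jqE.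
rewrite -(iota_le hK) -[leLHS]jpE linearB linear_sum /= -Tj.
have tail : `|T (jq x) - \sum_(m < N) (l m * f m (jq x)) *: y m|
    <= iota (eps / 2) * q x.
  apply/ler_addgt0Pr => e e0.
  have /cvgrPdist_lt /(_ e e0) [N' _ HN'] := Tsum (jq x).
  pose n := maxn N N'.
  have := HN' n (leq_maxr _ _) => /= /ltW Hn.
  have -> : T (jq x) - \sum_(m < N) (l m * f m (jq x)) *: y m =
      \sum_(N <= m < n) (l m * f m (jq x)) *: y m +
      (T (jq x) - series (fun n => (l n * f n (jq x)) *: y n) n).
    have -> : series (fun n => (l n * f n (jq x)) *: y n) n =
        \sum_(m < N) (l m * f m (jq x)) *: y m +
        \sum_(N <= m < n) (l m * f m (jq x)) *: y m.
      by rewrite /series /= (big_cat_nat (n := N)) ?leq_maxl //= big_mkord.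
    by rewrite opprD [in RHS]addrC -!addrA addNr addr0.
  apply: le_trans (ler_normD _ _) _; apply: lerD => //.
  apply: le_trans (ler_norm_sum _ _ _) _.
  apply: le_trans (ler_wpM2r (q_ge0 x) (HN n (leq_maxl _ _))).
  rewrite mulr_suml; apply: ler_sum => m _; rewrite normrZ normrM -mulrA.
  apply: ler_wpM2l => //; rewrite -jqE -[leRHS]mulr1; exact: ler_pM.
have head : `|\sum_(m < N) ((l m * f m (jq x)) *: y m - f m (jq x) *: jp (l m *: w m))|
    <= iota (eps / 2) * q x.
  apply: (@le_trans _ _ (\sum_(m < N) `|l m| * (eta * q x))).
    apply: le_trans (ler_norm_sum _ _ _) _; apply: ler_sum => m _.
    rewrite [jp (_ *: _)]linearZ /= scalerA [f m _ * _]mulrC -scalerBr normrZ normrM -mulrA.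
    apply: ler_wpM2l => //; rewrite mulrC -jqE; apply: ler_pM => //.
    exact: ltW.
  rewrite -mulr_suml -/L mulrA; apply: ler_wpM2r => //.
  rewrite /eta mulrA ler_pdivrMr // mulrC; apply: ler_wpM2l; first exact: ltW.
  by rewrite lerDr.
have -> : T (jq x) - \sum_(m < N) jp (f m (jq x) *: (l m *: w m)) =
   (T (jq x) - \sum_(m < N) (l m * f m (jq x)) *: y m) +
   \sum_(m < N) ((l m * f m (jq x)) *: y m - f m (jq x) *: jp (l m *: w m)).
  rewrite sumrB addrA subrK; congr (_ - _); apply: eq_bigr => m _.
  by rewrite linearZ.
apply: le_trans (ler_normD _ _) _; apply: le_trans (lerD tail head) _.
rewrite -mulrDl -rmorphD -splitr rmorphM; apply: ler_wpM2l => //.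
by rewrite (iota_ge0 hK) ltW.
Qed.

End GradedTopology.

(** * Equicontinuity and biorthogonal expansions in complete spaces *)

Section CompleteGradedSpaces.
Variables (R : realType) (K : numFieldType).
Variables (iota : {rmorphism R -> K}) (nrm : K -> R).
Hypothesis hK : scalar_modulus iota nrm.
Variables (E : tvsType K) (P : nat -> E -> R).
Hypothesis hP : graded_norms nrm P.
Hypothesis hT : graded_topology P.
Hypothesis hE : complete_tvs E.

Let Pn i := gn_norm hP i.

(** The [m]-th step is only measured by the norm of index [j m]. As the norms at
    least double with the index, an earlier norm sees the later steps as a
    geometric series. *)
Lemma fast_cauchy (x : nat -> E) (j : nat -> nat) :
  (forall m, (j m < j m.+1)%N) -> (forall m, P (j m) (x m.+1 - x m) <= 1) ->
  exists y : E, forall m, P (j m) (y - x m) <= 3.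
Proof.
move=> jm xj.
have step d : forall m, P (j m) (x (m + d)%N - x m) <= 2.
  elim: d => [|d IH] m; first by rewrite addn0 subrr (rn0 hK (Pn _)).
  have := rn_split (Pn (j m)) (x (m + d.+1)%N) (x m.+1) (x m).
  have := IH m.+1; rewrite addSnnS; have := xj m.
  have := gn_double hP (j m) (x (m + d.+1)%N - x m.+1).
  have := gn_mono hK hP (x (m + d.+1)%N - x m.+1) (jm m); lra.
have far m l : (m <= l)%N -> P (j m) (x l - x m) <= 2.
  by move=> ml; rewrite -(subnKC ml); exact: step.
have j_ge m : (m <= j m)%N by elim: m => // m IH; exact: leq_ltn_trans (jm m).
have [y xy] : exists y : E, x @ \oo --> y.
  apply: (cauchy_graded hT hE) => r e e0.
  pose k := Num.bound (4 / e).
  have ke : 4 / e < 2 ^+ k by apply: upper_nthrootP; exact: leqnn.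
  have near_rk l : (r + k <= l)%N -> 2 ^+ k * P r (x l - x (r + k)%N) <= 2.
    move=> rl; apply: le_trans (gn_power hP _ _ _) _.
    apply: le_trans (far _ _ rl); exact: (gn_mono hK hP).
  exists (r + k)%N => l l' /near_rk Hl /near_rk Hl'.
  have := rn_split (Pn r) (x l) (x (r + k)%N) (x l').
  rewrite (rn_dist hK (Pn r) (x (r + k)%N)) => tri.
  have k0 : 0 < 2 ^+ k :> R by rewrite exprn_gt0.
  rewrite -(ltr_pM2l k0); apply: (@le_lt_trans _ _ 4).
    move: tri; rewrite -(ler_pM2l k0); lra.
  by rewrite -ltr_pdivrMr.
exists y => m; have [N HN] := (cvg_graded hT x y).1 xy (j m) 1 ltr01.
have := HN _ (leq_maxl N m); have := far m _ (leq_maxr N m).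
have := rn_split (Pn (j m)) y (x (maxn N m)) (x m).
rewrite (rn_dist hK (Pn (j m)) y (x (maxn N m))); lra.
Qed.

(** A gliding hump. If the conclusion fails for [i], a perturbation that is small
    for [P j] can make some [P i (T n _)] as large as desired: one of [x + xi] and
    [x - xi] has an image at least as large as that of [xi]. The later
    perturbations are small for a norm that controls the operators already used,
    so the limit point is unbounded under the family. *)
Lemma uniform_boundedness (T : nat -> {linear E -> E}) :
  (forall n, continuous (T n)) ->
  (forall x i, exists C, forall n, P i (T n x) <= C) ->
  forall i, exists j, forall n x, P i (T n x) <= P j x.
Proof.
move=> Tc Tb i; apply: contrapT => no.
have bump j (M : R) : 0 < M -> exists n x, P j x <= 1 /\ M <= P i (T n x).
  move=> M0; have [j' _ Hj'] := gn_absorb hK hP j M.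
  have [n [x lt]] : exists n x, P j' x < P i (T n x).
    apply: contrapT => no'; apply: no; exists j' => n x.
    by rewrite leNgt; apply/negP => lt; apply: no'; exists n, x.
  have T0 : 0 < P i (T n x) by apply: le_lt_trans lt; exact: (gn_ge0 hK hP).
  have r0 : 0 <= M / P i (T n x) by rewrite divr_ge0 // ltW.
  exists n, (iota (M / P i (T n x)) *: x).
  rewrite linearZ /= !(rn_scale (Pn _)) (nrm_iota hK) // divfK ?gt_eqF //.
  split=> //; rewrite mulrAC ler_pdivrMr // mul1r.
  by apply: le_trans (Hj' x) _; exact: ltW.
(* One step: from the stage [m], a point and the index of a norm, to the next
   point and an index controlling the operator just used. *)
have /choice[F HF] (mst : nat * (E * nat)) : exists st' : E * nat,
    [/\ (mst.2.2 < st'.2)%N, P mst.2.2 (st'.1 - mst.2.1) <= 1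
      & exists n, mst.1%:R <= P i (T n st'.1) /\
                  forall y, P i (T n y) <= P st'.2 y].
  move: mst => [m [x j]] /=.
  have [n [xi [xi1 xiM]]] := bump j m.+1%:R (ltr0Sn _ _).
  have [j1 Hj1] := linear_bounded hK hP hT (Tc n) i.
  have mS : m%:R <= m.+1%:R :> R by rewrite ler_nat.
  have fin x' : P j (x' - x) <= 1 -> P i (T n xi) <= P i (T n x') ->
      exists st' : E * nat, [/\ (j < st'.2)%N, P j (st'.1 - x) <= 1
      & exists n, m%:R <= P i (T n st'.1) /\ forall y, P i (T n y) <= P st'.2 y].
    move=> xx' TT; exists (x', maxn j.+1 j1); split=> //=; first exact: leq_maxl.
    exists n; split; first exact: le_trans mS (le_trans xiM TT).
    move=> y; apply: le_trans (Hj1 y) _; apply: (gn_mono hK hP); exact: leq_maxr.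
  have [le|lt] := leP (P i (T n xi)) (P i (T n (x + xi))).
    by apply: (fin (x + xi)) => //; rewrite addrAC subrr add0r.
  apply: (fin (x - xi)); first by rewrite addrAC subrr add0r (rnN hK (Pn j)).
  have := rn_sub hK (Pn i) (T n (x + xi)) (T n (x - xi)).
  rewrite -linearB opprB [x + xi + _]addrC addrA subrK linearD.
  have -> : T n xi + T n xi = iota 2 *: T n xi.
    by rewrite (rmorph_nat iota 2) scaler_nat mulr2n.
  rewrite (rn_scale (Pn i)) (nrm_iota hK) //; lra.
pose s := fix s m := if m is m'.+1 then F (m', s m') else (0, 0%N).
have [||x Hx] := @fast_cauchy (fun m => (s m).1) (fun m => (s m).2).
- by move=> m; have [] := HF (m, s m).
- by move=> m; have [] := HF (m, s m).
have [C HC] := Tb x i.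
have [_ _ [n [Tn Tj]]] := HF (Num.bound (C + 3), s (Num.bound (C + 3))).
set m := Num.bound _ in Tn Tj.
have Cm : C + 3 < m%:R.
  have [C0|C0] := leP 0 (C + 3); first exact: archi_boundP.
  exact: lt_le_trans C0 (ler0n _ _).
have := Tj (x - (s m.+1).1); have := Hx m.+1; have := HC n.
have := rn_sub hK (Pn i) (T n x) (T n (x - (s m.+1).1)).
rewrite -linearB subKr; move: Tn Cm => /=; lra.
Qed.

Lemma linear_combination_cvg (u v : nat -> E) (x y : E) a :
  u @ \oo --> x -> v @ \oo --> y ->
  (fun n => a *: u n + v n) @ \oo --> a *: x + y.
Proof.
move=> /(cvg_graded hT u x) ux /(cvg_graded hT v y) vy.
apply/(cvg_graded hT) => i e e0.
have b0 : 0 < nrm a + 1 by rewrite ltr_wpDl // (nrm_ge0 hK).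
have d0 : 0 < e / 2 / (nrm a + 1) by rewrite !divr_gt0.
have e2 : 0 < e / 2 by rewrite divr_gt0.
have [N HN] := ux i _ d0; have [N' HN'] := vy i _ e2.
exists (maxn N N') => n; rewrite geq_max => /andP[/HN Hu /HN' Hv].
have -> : a *: u n + v n - (a *: x + y) = a *: (u n - x) + (v n - y).
  by rewrite scalerBr opprD addrACA.
apply: le_lt_trans (rn_add (Pn i) _ _) _; rewrite (rn_scale (Pn i)).
move: Hu; rewrite ltr_pdivlMr // => Hu.
have := gn_ge0 hK hP i (u n - x); nra.
Qed.

(** Pointwise convergence to [0] of the [A n] is uniform on the unit ball of a
    stronger norm: the remainder of a finite-rank approximation of [x] is handled
    by equicontinuity, and the finite-rank part by convergence on finitely many
    vectors. *)
Lemma fdd_vanishing (A : nat -> {linear E -> E}) : fdd A -> nuclear_space E ->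
  forall i, exists j, forall eps : R, 0 < eps ->
    exists N, forall n, (N <= n)%N -> forall x, P i (A n x) <= eps * P j x.
Proof.
move=> [Ac _ _ Acvg] nucE i.
have A0 x i' e : 0 < e -> exists N, forall n, (N <= n)%N -> P i' (A n x) < e.
  move=> e0; have /(cvg_graded hT) Ax := Acvg x.
  have e2 : 0 < e / 2 by rewrite divr_gt0.
  have [N HN] := Ax i' _ e2; exists N => n Nn.
  have := HN _ Nn; have := HN _ (leqW Nn).
  have := rn_sub hK (Pn i') (series (fun n => A n x) n.+1 - x)
    (series (fun n => A n x) n - x).
  have -> : series (fun n => A n x) n.+1 - x - (series (fun n => A n x) n - x) = A n x.
    by rewrite /series /= big_nat_recr //= opprB addrA subrK addrAC subrr add0r.
  lra.
have [j0 Hj0] : exists j, forall n x, P i (A n x) <= P j x.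
  apply: uniform_boundedness => // x i'; have [N HN] := A0 x i' 1 ltr01.
  exists (1 + \sum_(n < N) P i' (A n x)) => n.
  have [/HN/ltW Nn|nN] := leqP N n.
    by apply: le_trans Nn _; rewrite lerDl sumr_ge0 // => m _; exact: (gn_ge0 hK hP).
  rewrite (bigD1 (Ordinal nN)) //= addrCA lerDl addr_ge0 // sumr_ge0 // => m _.
  exact: (gn_ge0 hK hP).
have [j Hj] := nuclear_finite_rank hK hP hT nucE j0.
exists j => eps eps0; have e2 : 0 < eps / 2 by rewrite divr_gt0.
have [M [g [v [gP finr]]]] := Hj _ e2.
have d0 : 0 < eps / 2 / M.+1%:R by rewrite divr_gt0 // ltr0n.
have [N HN] : exists N, forall m, (m < M)%N -> forall n, (N <= n)%N ->
    P i (A n (v m)) < eps / 2 / M.+1%:R.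
  apply: common_index => [m N N' NN' + n Nn|m _]; last exact: A0.
  by apply; exact: leq_trans Nn.
exists N => n Nn x.
rewrite -[x](subrK (\sum_(m < M) g m x *: v m)) linearD subrK.
apply: le_trans (rn_add (Pn i) _ _) _; rewrite [eps]splitr mulrDl; apply: lerD.
  exact: le_trans (Hj0 n _) (finr x).
have -> : A n (\sum_(m < M) g m x *: v m) = lincomb M (A n \o v) (g^~ x).
  by rewrite linear_sum; apply: eq_bigr => m _; rewrite linearZ.
apply: le_trans (rn_lincomb hK (Pn i) _ _ _) _.
apply: (@le_trans _ _ (\sum_(m < M) P j x * (eps / 2 / M.+1%:R))).
  apply: ler_sum => m _; apply: ler_pM => //.
  - exact: nrm_ge0 hK _.
  - exact: (gn_ge0 hK hP).
  - by apply: ltW; exact: HN.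
rewrite sumr_const card_ord -[_ *+ M]mulr_natr -mulrA mulrC.
apply: ler_wpM2r; first exact: (gn_ge0 hK hP).
rewrite -mulrA ger_pMr // mulrC ler_pdivrMr ?ltr0n // mul1r ler_nat //.
Qed.

Section Expansion.
Variables (g : nat -> E) (c : nat -> {linear E -> K^o}).
Hypothesis biorthogonal : forall q r, c q (g r) = (q == r)%:R.
Hypothesis decay : forall i, exists l, forall q x,
  nrm (c q x) * P i (g q) <= 2^-1 ^+ q * P l x.

Lemma coordinate_bounded q : exists j, forall x, nrm (c q x) <= P j x.
Proof.
have [l Hl] := decay 0.
have g0 : 0 < P 0%N (g q).
  apply: (rn_gt0 hK (Pn 0)); apply/eqP => gq0.
  have := biorthogonal q q; rewrite gq0 linear0 eqxx => /esym/eqP.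
  by rewrite oner_eq0.
have [j _ Hj] := gn_absorb hK hP l (2^-1 ^+ q / P 0%N (g q)).
exists j => x; apply: le_trans (Hj x); rewrite mulrAC ler_pdivlMr //; exact: Hl.
Qed.

(** Limits of a coordinate along a sequence are only needed when the coordinate
    is eventually constant, as it is on partial sums. *)
Lemma coordinate_limit q (u : nat -> E) (x : E) b N : u @ \oo --> x ->
  (forall n, (N <= n)%N -> c q (u n) = b) -> c q x = b.
Proof.
move=> /(cvg_graded hT u x) ux ub; have [j Hj] := coordinate_bounded q.
apply/eqP; rewrite -subr_eq0; apply/eqP/(nrm_eq0 hK)/eqP.
rewrite eq_le (nrm_ge0 hK) andbT; apply/ler_addgt0Pl => e e0; rewrite addr0.
have [N' HN'] := ux j e e0.
rewrite -(ub _ (leq_maxl N N')) -linearB; apply: le_trans (Hj _) _.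
by rewrite (rn_dist hK (Pn j)) ltW // HN' // leq_maxr.
Qed.

Lemma coordinate_series q (a : nat -> K) n : (q < n)%N ->
  c q (series (fun r => a r *: g r) n) = a q.
Proof.
move=> qn; rewrite /series /= big_mkord linear_sum (bigD1 (Ordinal qn)) //=.
rewrite linearZ /= biorthogonal eqxx big1 => [|r rq].
  by rewrite addr0 /GRing.scale /= mulr1.
rewrite linearZ /= biorthogonal /GRing.scale /=.
suff -> : (q == r) = false by rewrite mulr0.
by apply/negbTE; apply: contraNneq rq => qr; apply/eqP/val_inj.
Qed.

Lemma coordinate_expansion q (a : nat -> K) x :
  series (fun r => a r *: g r) @ \oo --> (x : E) -> c q x = a q.
Proof.
by move=> ax; apply: (coordinate_limit (N := q.+1) ax) => n; exact: coordinate_series.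
Qed.

Let S x := series (fun q => c q x *: g q).

Lemma expansion_tail i l x :
  (forall q, nrm (c q x) * P i (g q) <= 2^-1 ^+ q * P l x) ->
  forall m n, (m <= n)%N -> P i (S x n - S x m) <= 2 * 2^-1 ^+ m * P l x.
Proof.
move=> Hl m n mn.
suff H : P i (S x n - S x m) <= (2 * 2^-1 ^+ m - 2 * 2^-1 ^+ n) * P l x.
  apply: le_trans H _; apply: ler_wpM2r; first exact: (gn_ge0 hK hP).
  by rewrite gerBl mulr_ge0 // exprn_ge0 // invr_ge0.
elim: n mn => [|n IH].
  by rewrite leqn0 => /eqP ->; rewrite !subrr mul0r (rn0 hK (Pn i)).
rewrite leq_eqVlt => /predU1P[->|]; first by rewrite !subrr mul0r (rn0 hK (Pn i)).
rewrite ltnS => /IH mn.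
have -> : S x n.+1 - S x m = (S x n - S x m) + c n x *: g n.
  by rewrite /S /series /= big_nat_recr //= addrAC.
apply: le_trans (rn_add (Pn i) _ _) _; rewrite (rn_scale (Pn i)).
have := Hl n; rewrite exprS; lra.
Qed.

(** The decay makes the expansion converge absolutely for every norm, with a
    bound by a single norm of [x], hence continuity. *)
Lemma expansion_projection : exists F : {linear E -> E},
  [/\ continuous F, forall x, S x @ \oo --> F x & forall q, F (g q) = g q].
Proof.
have /choice[F HF] x : exists y : E, S x @ \oo --> y.
  apply: (cauchy_graded hT hE) => i e e0; have [l Hl] := decay i.
  pose k := Num.bound (4 * (P l x) / e).
  have ke : 4 * P l x / e < 2 ^+ k by apply: upper_nthrootP; exact: leqnn.
  have k0 : 0 < 2 ^+ k :> R by rewrite exprn_gt0.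
  have tail n : (k <= n)%N -> 2 ^+ k * P i (S x n - S x k) <= 2 * P l x.
    move=> kn; have := expansion_tail (fun q => Hl q x) kn.
    by rewrite exprVn mulrAC ler_pdivlMr // mulrC.
  exists k => m n /tail Hm /tail Hn.
  have := rn_split (Pn i) (S x m) (S x k) (S x n).
  rewrite (rn_dist hK (Pn i) (S x k)) => tri.
  rewrite -(ltr_pM2l k0); apply: (@le_lt_trans _ _ (4 * P l x)).
    by move: tri; rewrite -(ler_pM2l k0); lra.
  by rewrite -ltr_pdivrMr.
have Flin : linear F.
  move=> a x y; apply: (cvg_graded_unique hK hP hT (HF _)).
  have -> : S (a *: x + y) = (fun n => a *: S x n + S y n).
    apply/funext => n; rewrite /S /series /= scaler_sumr -big_split /=.
    by apply: eq_bigr => q _; rewrite linearP /= scalerDl scalerA.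
  exact: linear_combination_cvg.
pose FL : {linear E -> E} :=
  HB.pack F (GRing.isLinear.Build K E E *:%R F Flin).
have FLc : continuous FL.
  apply: (bounded_continuous hT) => i; have [l Hl] := decay i.
  have [j _ Hj] := gn_absorb hK hP l 2; exists j => x.
  apply: le_trans (Hj x); apply/ler_addgt0Pl => e e0.
  have [N HN] := (cvg_graded hT (S x) (F x)).1 (HF x) i e e0.
  have := HN N (leqnn N); have := expansion_tail (fun q => Hl q x) (leq0n N).
  have -> : S x 0%N = 0 by rewrite /S /series /= big_geq.
  have := rn_split (Pn i) (F x) (S x N) 0.
  by rewrite !subr0 (rn_dist hK (Pn i) (F x)) expr0 mulr1 /=; lra.
exists FL; split => //=.
- move=> q; apply: (cvg_graded_unique hK hP hT (HF _)).
  apply/(cvg_graded hT) => i e e0; exists q.+1 => n qn.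
  suff -> : S (g q) n = g q by rewrite subrr (rn0 hK (Pn i)).
  rewrite -[RHS](lincomb_delta g qn) /S /series /= big_mkord.
  by apply: eq_bigr => r _; rewrite biorthogonal.
Qed.

Lemma linear_fix_span (Y : set E) (F : {linear E -> E}) :
  (forall y, Y y -> F y = y) -> forall x, linear_span Y x -> F x = x.
Proof.
move=> FY x [n [a [s [Ys ->]]]]; rewrite linear_sum.
by apply: eq_bigr => i _; rewrite linearZ /= FY.
Qed.

(** The fixed points of the projection form a closed subspace that contains [g],
    hence [Y] and its closed span; conversely the values of the projection are
    limits of combinations of [g]. The set [Y] may be larger than the range of
    [g], as it is for a union of blocks. *)
Lemma biorthogonal_basis (Y : set E) :
  range g `<=` Y -> Y `<=` linear_span (range g) ->
  complemented (closed_span Y) /\ schauder_basis (closed_span Y) g.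
Proof.
move=> gY Yg; have [F [Fc FS Fg]] := expansion_projection.
have FY : forall x, linear_span Y x -> F x = x.
  apply: linear_fix_span => y /Yg.
  by apply: linear_fix_span => _ [q _ <-].
have Fspan x : closed_span Y x -> F x = x.
  move=> /(closure_graded hT) Hx; apply: (graded_eq hK hP) => e e0.
  have [j Hj] := linear_bounded hK hP hT Fc 0.
  have e2 : 0 < e / 2 by rewrite divr_gt0.
  have [v /FY Fv vx] := Hx j _ e2.
  have H1 : P 0%N (v - x) <= P j (v - x) by exact: (gn_mono hK hP).
  have := rn_split (Pn 0) (F x) v x; have := Hj (x - v).
  rewrite linearB Fv (rn_dist hK (Pn j)); lra.
have Frange x : closed_span Y (F x).
  apply/(closure_graded hT) => i e e0.
  have [N HN] := (cvg_graded hT (S x) (F x)).1 (FS x) i e e0.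
  exists (S x N); last exact: HN.
  exists N, (fun q => c q x), (fun q => g q); split; first by move=> q; apply: gY; exists q.
  by rewrite /S /series /= big_mkord.
split.
  exists F; split=> // [x|]; first exact: Fspan.
  apply/seteqP; split=> [_ [x _ <-]//|x Vx]; by exists x => //; exact: Fspan.
split=> [n|]; first by rewrite -[g n]Fg; exact: Frange.
exists (fun q x => c q x); split=> [n|x Vx|x Vx a ax n].
- apply: continuous_subspaceT.
  apply: (bounded_functional_continuous hK hP hT); last exact: coordinate_bounded.
  by move=> x y; rewrite linearB.
- by rewrite -[X in _ --> X](Fspan x Vx); exact: FS.
- by apply/esym; exact: coordinate_expansion ax.
Qed.
End Expansion.

End CompleteGradedSpaces.

(** * Subsequences of a decomposition into blocks of equal dimension *)

Section Subsequences.
Variables (U : set_system nat).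
Context {UU : UltraFilter U}.
Hypothesis Uoo : \oo `<=` U.

Lemma extract_subsequence (G : nat -> nat -> Prop) :
  (forall N, \forall n \near U, G N n) ->
  exists theta : nat -> nat, (forall N, (theta N < theta N.+1)%N) /\
    forall N, G N (theta N).
Proof.
move=> GU.
have /choice[F HF] (Nm : nat * nat) : exists n, (Nm.2 < n)%N /\ G Nm.1 n.
  case: Nm => N m /=; have H : \forall n \near U, (m < n)%N by apply: Uoo; exists m.+1.
  by have [n [mn Gn]] := filter_ex (filterI H (GU N)); exists n.
pose theta := fix th N := F (N, if N is N'.+1 then th N' else 0%N).
exists theta; split=> [N|[|N]].
- by have [] := HF (N.+1, theta N).
- by have [] := HF (0%N, 0%N).
- by have [] := HF (N.+1, theta N).
Qed.

End Subsequences.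

Lemma increasing_inj (theta : nat -> nat) :
  (forall N, (theta N < theta N.+1)%N) -> injective theta.
Proof.
move=> th; have mono := homo_ltn ltn_trans th.
by move=> m n mn; have [/mono|/mono|//] := ltngtP m n; rewrite mn ltnn.
Qed.

Lemma infinite_range (theta : nat -> nat) :
  injective theta -> infinite_set (range theta).
Proof.
move=> inj; rewrite (eq_finite_set (inj_card_eq _)); first exact: infinite_nat.
by move=> m n _ _; exact: inj.
Qed.

Lemma coordinate_functionals (K : numFieldType) (E : lmodType K) m
    (e : nat -> E) (f : {linear E -> E}) :
  independent m e -> (forall y, exists a, f y = lincomb m e a) ->
  exists c : nat -> {linear E -> K^o}, forall y, f y = lincomb m e (fun h => c h y).
Proof.
move=> ind /choice[a Ha].
have /choice[c Hc] h : exists c : {linear E -> K^o}, (h < m)%N -> forall y, c y = a y h.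
  have lin : linear (fun y => (if (h < m)%N then a y h else 0) : K^o).
    move=> r x y; case: ifP => [hm|_]; last by rewrite scaler0 addr0.
    apply: (independent_inj (b := fun h => r * a x h + a y h) ind _ hm).
    by rewrite -lincombD -lincombZ -!Ha linearP.
  pose c : {linear E -> K^o} :=
    HB.pack (fun y => (if (h < m)%N then a y h else 0) : K^o)
      (GRing.isLinear.Build K E K^o *:%R _ lin).
  by exists c => hm y; rewrite /c /= hm.
by exists c => y; rewrite Ha; apply: eq_lincomb => // h /Hc ->.
Qed.

Section Decomposition.
Variables (R : realType) (K : numFieldType).
Variables (iota : {rmorphism R -> K}) (nrm : K -> R).
Hypothesis hK : scalar_modulus iota nrm.
Variables (E : tvsType K) (P : nat -> E -> R).
Hypothesis hP : graded_norms nrm P.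
Hypothesis hT : graded_topology P.
Hypothesis hE : complete_tvs E.
Hypothesis nucE : nuclear_space E.
Variables (k : nat) (A : nat -> {linear E -> E}).
Hypothesis k_gt0 : (0 < k)%N.
Hypothesis hA : k_dim_decomposition k A.

Let Pn i := gn_norm hP i.

(** Adaptedness followed by [fdd_vanishing] makes the quantity to be estimated
    arbitrarily small for almost all [n], which is what a sparse subsequence
    turns into geometric decay. The exponent [N.+1 * k] leaves room for listing
    the [k] vectors of each block one after the other. *)
Lemma adapted_subsequence (x : nat -> E) :
  (forall n, range (A n) (x n)) -> (forall n, x n != 0) ->
  exists (theta : nat -> nat) (e : nat -> nat -> E) (c : nat -> nat -> {linear E -> K^o}),
    [/\ (forall N, (theta N < theta N.+1)%N) /\ forall n, e 0%N n = x n,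
        forall n, range (A n) = [set lincomb k (e^~ n) a | a in setT],
        forall h l n m, (h < k)%N -> (l < k)%N ->
          c h n (e l m) = ((n == m) && (h == l))%:R
      & forall i, exists l, forall N h y, (h < k)%N ->
          nrm (c h (theta N) y) * P i (e h (theta N)) <= 2^-1 ^+ (N.+1 * k) * P l y].
Proof.
move=> Ax xnz; have [Afdd Adim] := hA; have [_ _ AA _] := Afdd.
have [U [UU Uoo]] := ultraFilterLemma (F := \oo) _.
have [e [e0 ind AE ade]] := adapted_basis hK hP Uoo k_gt0 Adim Ax xnz.
have /choice[cT HcT] n : exists c : nat -> {linear E -> K^o},
    forall y, A n y = lincomb k (e^~ n) (fun h => c h y).
  apply: coordinate_functionals => [|y]; first exact: ind.
  have : range (A n) (A n y) by exists y.
  by rewrite AE => -[a _ <-]; exists a.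
pose c h n := cT n h.
have ce h l n m : (h < k)%N -> (l < k)%N ->
    c h n (e l m) = ((n == m) && (h == l))%:R.
  move=> hk lk; have : range (A m) (e l m).
    by rewrite AE; exists (fun r => (r == l)%:R) => //; exact: lincomb_delta.
  move=> [z _ Az].
  apply: (independent_inj (m := k) (e := e^~ n)
    (a := fun h => c h n (e l m)) (b := fun h => ((n == m) && (h == l))%:R) (ind n)) => //.
  rewrite -HcT -Az AA [m == n]eq_sym; have [->|_] := eqVneq n m.
    by rewrite Az -[LHS](lincomb_delta (e^~ m) lk).
  by rewrite /lincomb big1 // => r _; rewrite scale0r.
have /choice[l Hl] i : exists l, forall eps : R, 0 < eps -> \forall n \near U,
    forall y h, (h < k)%N -> nrm (c h n y) * P i (e h n) <= eps * P l y.
  have [j Hj] := ade i; have [l Hl] := fdd_vanishing hK hP hT hE Afdd nucE j.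
  exists l => eps eps0; have [M HM] := Hl eps eps0.
  near=> n => y h hk; apply: (@le_trans _ _ (P j (A n y))).
    rewrite (HcT n y).
    have H : forall a h, (h < k)%N ->
      nrm (a h) * P i (e h n) <= P j (lincomb k (e^~ n) a) by near: n.
    exact: (H (fun h => c h n y)).
  move: y {hk}; near: n; apply: Uoo; exists M => // n; exact: HM.
pose eps N : R := 2^-1 ^+ (N.+1 * k).
have eps_gt0 N : 0 < eps N by rewrite exprn_gt0 // invr_gt0.
have [theta [th_inc Hth]] := extract_subsequence Uoo (G := fun N n =>
    forall i, (i < N.+1)%N -> forall y h, (h < k)%N ->
      nrm (c h n y) * P i (e h n) <= eps N * P (l i) y)
  (fun N => near_below (fun i _ => Hl i _ (eps_gt0 N))).
exists theta, e, c; split=> // i.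
have e_gt0 i' h n : (h < k)%N -> 0 < P i' (e h n).
  by move=> hk; apply: (rn_gt0 hK (Pn i')); exact: (independent_neq0 (ind n) hk).
have up j j' h N y : (j <= j')%N -> nrm (c h (theta N) y) * P i (e h (theta N)) <= eps N * P j y ->
    nrm (c h (theta N) y) * P i (e h (theta N)) <= eps N * P j' y.
  move=> jj' /le_trans; apply; apply: ler_wpM2l; first exact: ltW.
  exact: (gn_mono hK hP).
(* The subsequence meets the condition of index [i] from its [i]-th term on. It
   meets the one of index [0] everywhere, and in each of the finitely many
   remaining blocks this bounds the coordinates by some norm. *)
have [j Hj] : exists j, forall N, (N < i)%N -> forall h, (h < k)%N -> forall y,
    nrm (c h (theta N) y) * P i (e h (theta N)) <= eps N * P j y.
  apply: common_index => [N j j' jj' H h hk y|N _].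
    by apply: up jj' _; exact: H.
  apply: common_index => [h j j' jj' H y|h hk]; first by apply: up jj' _; exact: H.
  have e0_gt0 := e_gt0 0%N h (theta N) hk.
  have [j _ Hj] := gn_absorb hK hP (l 0%N) (P i (e h (theta N)) / P 0%N (e h (theta N))).
  exists j => y; have H0 := Hth N 0%N isT y h hk.
  apply: le_trans (ler_wpM2l (ltW (eps_gt0 N)) (Hj y)).
  set p0 := P 0%N _ in e0_gt0 H0 *; set pi := P i _.
  have -> : nrm (c h (theta N) y) * pi = nrm (c h (theta N) y) * p0 * (pi / p0).
    by rewrite -mulrA [p0 * _]mulrC divfK // gt_eqF.
  rewrite [leRHS]mulrCA [leRHS]mulrC; apply: ler_wpM2r H0.
  by rewrite divr_ge0 ?(gn_ge0 hK hP).
exists (maxn j (l i)) => N h y hk; have [Ni|iN] := ltnP N i.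
  by apply: up (leq_maxl _ _) _; exact: Hj.
by apply: up (leq_maxr _ _) _; exact: Hth.
Unshelve. all: by end_near. Qed.

Lemma decay_weaken (q M : nat) : (q <= M)%N -> 2^-1 ^+ M <= 2^-1 ^+ q :> R.
Proof.
by move=> qM; apply: ler_wiXn2l => //; rewrite ?invr_ge0 ?invf_le1 ?ler1n.
Qed.

Lemma complemented_subsequence (x : nat -> E) :
  (forall n, range (A n) (x n)) -> (forall n, x n != 0) ->
  exists2 M : set nat, infinite_set M & complemented (closed_span (x @` M)).
Proof.
move=> Ax xnz.
have [theta [e [c [[th_inc e0] _ ce decay]]]] := adapted_subsequence Ax xnz.
have th_inj := increasing_inj th_inc.
exists (range theta); first exact: infinite_range.
suff [] : complemented (closed_span (x @` range theta)) /\
  schauder_basis (closed_span (x @` range theta)) (x \o theta) by [].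
apply: (biorthogonal_basis hK hP hT hE (c := fun N => c 0%N (theta N))).
- by move=> q r; rewrite /= -e0 ce // (inj_eq th_inj) andbT.
- move=> i; have [l Hl] := decay i; exists l => q y; rewrite /= -e0.
  apply: le_trans (Hl q 0%N y k_gt0) _; apply: ler_wpM2r; first exact: (gn_ge0 hK hP).
  by apply: decay_weaken; exact: leq_trans (leqnSn q) (leq_pmulr _ k_gt0).
- by move=> _ [N _ <-]; exists (theta N) => //; exists N.
- move=> _ [_ [N _ <-] <-]; exists 1%N, (fun=> 1), (fun=> x (theta N)).
  by split=> [_|]; [exists N|rewrite big_ord1 scale1r].
Qed.

(** The vector [g q] is the one of index [q %% k] in the [q %/ k]-th block of the
    subsequence. *)
Lemma basis_of_blocks :
  exists2 M : set nat, infinite_set M &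
    has_basis (closed_span (\bigcup_(n in M) range (A n))).
Proof.
have [_ Adim] := hA.
have /choice[x Hx] n : exists x, range (A n) x /\ x != 0.
  have [d [ind ->]] := has_dimP (Adim n); exists (d 0%N); split.
    by exists (fun r => (r == 0%N)%:R) => //; exact: lincomb_delta.
  exact: independent_neq0 ind k_gt0.
have [theta [e [c [[th_inc _] AE ce decay]]]] :=
  adapted_subsequence (fun n => (Hx n).1) (fun n => (Hx n).2).
have th_inj := increasing_inj th_inc.
exists (range theta); first exact: infinite_range.
pose g q := e (q %% k)%N (theta (q %/ k)%N).
suff [_ gbasis] : complemented (closed_span (\bigcup_(n in range theta) range (A n))) /\
  schauder_basis (closed_span (\bigcup_(n in range theta) range (A n))) g by exists g.
apply: (biorthogonal_basis hK hP hT hE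
  (c := fun q => c (q %% k)%N (theta (q %/ k)%N))).
- move=> q r; rewrite /g ce ?ltn_pmod // (inj_eq th_inj); congr (nat_of_bool _)%:R.
  apply/idP/idP => [/andP[/eqP qr /eqP qr']|/eqP ->]; last by rewrite !eqxx.
  by rewrite (divn_eq q k) (divn_eq r k) qr qr' eqxx.
- move=> i; have [l Hl] := decay i; exists l => q y.
  apply: le_trans (Hl (q %/ k)%N (q %% k)%N y (ltn_pmod _ k_gt0)) _.
  apply: ler_wpM2r; first exact: (gn_ge0 hK hP).
  by apply: decay_weaken; apply: ltnW; rewrite -ltn_divLR.
- move=> _ [q _ <-]; exists (theta (q %/ k)%N); first by exists (q %/ k)%N.
  rewrite AE; exists (fun r => (r == q %% k)%N%:R) => //.
  by apply: lincomb_delta; exact: ltn_pmod.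
- move=> y [_ [N _ <-]]; rewrite AE => -[a _ <-].
  exists k, (fun h => a h), (fun h => e h (theta N)); split=> // h.
  exists (N * k + h)%N => //.
  by rewrite /g modnMDl divnMDl // modn_small // divn_small // addn0.
Qed.

End Decomposition.

Unset Implicit Arguments.
Set Strict Implicit.
Set Printing Implicit Defensive.

Theorem theorem1 (R : realType) (K : numFieldType) (hK : real_or_complex R K)
    (k : nat) (hk : (0 < k)%N) (E : tvsType K)
    (hF : frechet E) (hcn : countably_normed E) (hnuc : nuclear_space E)
    (A : nat -> {linear E -> E}) (hA : k_dim_decomposition k A) :
  (forall x : nat -> E, (forall n, range (A n) (x n)) -> (forall n, x n != 0) ->
     exists2 M : set nat, infinite_set M & complemented (closed_span (x @` M)))
  /\
  (exists2 M : set nat, infinite_set M &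
     has_basis (closed_span (\bigcup_(n in M) range (A n)))).
Proof.
have [iota [nrm hmod]] := real_or_complex_modulus hK.
have [P hP hT] := countably_normed_graded hmod hcn.
have [_ hE] := hF.
split=> [x|]; first exact: (complemented_subsequence hmod hP hT hE hnuc hk hA).
exact: (basis_of_blocks hmod hP hT hE hnuc hk hA).
Qed.
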